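(* Let $K$ be an $R$-ball convex body in $\mathbb{R}^n$ with $0$ in its interior and such that $$\mu_K\left(\left\{x\in\partial K:\kappa_i(K,x)>\tfrac1R\text{ for all }i,\ 1\le i\le n-1\right\}\right)>0.$$ (i) The function $p\mapsto\left(\frac{\Omega_p^R(K)}{\Omega_\infty^R(K)}\right)^{n+p}$ is decreasing in $p\in(-n,\infty)$. (ii) The function $p\mapsto\left(\frac{\Omega_p^R(K)}{\Omega_0^R(K)}\right)^{\frac{n+p}{p}}$ is increasing in $p\in(-n,\infty)$, $p\neq0$.
   Context: A convex body in $\mathbb{R}^n$ is a compact convex set with nonempty interior; $B^n_2$ is the closed Euclidean unit ball. For $R>0$, a convex body $K$ is $R$-ball convex if $K=\bigcap_{K\subset RB^n_2+x}(RB^n_2+x)$, i.e. it is the intersection of all closed balls of radius $R$ containing it. For $x\in\partial K$, $N(x)$ is the outer unit normal, $\kappa_i(K,x)$, $1\le i\le n-1$, are the principal curvatures (which exist almost everywhere on $\partial K$), $\kappa(K,x)=\prod_{i=1}^{n-1}\kappa_i(K,x)$ is the Gauss curvature, and $\mu_K$ is the surface area measure on $\partial K$. For $-\infty\le p\le\infty$, $p\neq-n$, the $L_p$-relative surface area of $K$ is $$\Omega_p^R(K)=\int_{\partial K}\left(\frac{\kappa(K,x)^{\frac{1}{n+1}}}{\langle x,N(x)\rangle}\right)^{\frac{n(p-1)}{n+p}}\prod_{i=1}^{n-1}\left(\kappa_i(K,x)-\frac1R\right)^{\frac{1}{n+1}}d\mu_K(x),$$ where for $p=\pm\infty$ the exponent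 $\frac{n(p-1)}{n+p}$ is read as $n$. ''Decreasing'' and ''increasing'' are meant in the weak (non-strict) sense. *)

(* Defs.v *)
From HB Require Import structures.
From mathcomp Require Import all_boot all_order all_algebra.
From mathcomp Require Import all_classical all_reals all_analysis.

Set Implicit Arguments.
Unset Strict Implicit.
Unset Printing Implicit Defensive.

Import Order.TTheory GRing.Theory Num.Theory.
Import numFieldNormedType.Exports.

Local Open Scope classical_set_scope.
Local Open Scope ring_scope.

(* The library norm on 'rV[R]_n is the max norm, hence [enorm]; its topology is
   the Euclidean one, so library closures, interiors and compacts are used. *)
Section euclidean.
Context {R : realType} {n : nat}.
Implicit Types (x y u : 'rV[R]_n) (K A : set 'rV[R]_n) (r : R).

Definition dot x y : R := (x *m y^T) 0 0.

Definition enorm x : R := Num.sqrt (dot x x).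

Definition eball x r : set 'rV[R]_n := [set y | enorm (y - x) <= r].

Definition bnd K : set 'rV[R]_n := closure K `\` interior K.

Definition convex_body K : Prop :=
  [/\ compact K, convex_set (K : set (convex_lmodType 'rV[R]_n))
    & interior K !=set0].

Definition ball_convex r K : Prop :=
  K = \bigcap_(x in [set x | K `<=` eball x r]) eball x r.

(* Supremum in \bar R of an empty family is -oo: [diam set0 = -oo]. *)
Definition diam A : \bar R :=
  ereal_sup [set (enorm (p.1 - p.2))%:E | p in A `*` A].

End euclidean.

(* A copy of a type on which every set is measurable, so that [mu_ext] ranges
   over covers by arbitrary sets. *)
Definition all_sets (T : Type) : Type := T.

Section all_sets.
Variable T : pointedType.

HB.instance Definition _ := Pointed.on (all_sets T).
HB.instance Definition _ := @isMeasurable.Build default_measure_display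
  (all_sets T) (fun=> True) I (fun _ _ => I) (fun _ _ => I).

End all_sets.

Section hausdorff_measure.
Context (R : realType) (n : nat).
Local Open Scope ereal_scope.

(* Volume of the Euclidean unit ball of dimension k, by
   omega_k = (2 pi / k) omega_(k-2). *)
Fixpoint ball_volume (k : nat) : R :=
  match k with
  | 0%N => 1%R
  | 1%N => 2%R
  | m.+2 => (2 * pi / m.+2%:R * ball_volume m)%R
  end.

(* Sets of diameter greater than d cost +oo, i.e. are not allowed in covers;
   as 0 ^+ 0 = 1, a point costs 1 when k = 0. *)
Definition gauge (k : nat) (d : R) (A : set (all_sets 'rV[R]_n)) : \bar R :=
  if A == set0 then 0
  else if diam A <= d%:E
  then (ball_volume k * (fine (diam A) / 2) ^+ k)%:E
  else +oo.

(* k-dimensional Hausdorff outer measure on R^n, normalised so that it agrees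
   with the Lebesgue measure when k = n. *)
Definition hausdorff (k : nat) (A : set 'rV[R]_n) : \bar R :=
  ereal_sup [set mu_ext (gauge k d) A | d in [set d : R | (0 < d)%R]].

Lemma ball_volume_ge0 k : (0 <= ball_volume k)%R.
Proof.
suff: (0 <= ball_volume k)%R /\ (0 <= ball_volume k.+1)%R by case.
elim: k => [|k [k0 k1]]; first by split => /=; rewrite ?ler01 ?ler0n.
split => //=; rewrite mulr_ge0// divr_ge0// mulr_ge0//.
exact: pi_ge0.
Qed.

Lemma gauge0 k d : gauge k d set0 = 0.
Proof. by rewrite /gauge eqxx. Qed.

Lemma gauge_ge0 k d A : 0 <= gauge k d A.
Proof.
rewrite /gauge; case: eqP => // /eqP/set0P[x Ax].
case: ifPn => // _; rewrite lee_fin mulr_ge0 ?ball_volume_ge0//.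
rewrite exprn_ge0// divr_ge0// fine_ge0//.
apply: le_trans (ereal_sup_ubound _); last by exists (x, x).
by rewrite lee_fin sqrtr_ge0.
Qed.

Lemma hausdorff0 k : hausdorff k set0 = 0.
Proof.
have g0 d : mu_ext (gauge k d) set0 = 0 :> \bar R.
  by apply: mu_ext0; [exact: gauge0|move=> A; exact: gauge_ge0].
apply/eqP; rewrite eq_le; apply/andP; split.
  by apply: ge_ereal_sup => _ [d _ <-]; rewrite g0.
by rewrite -(g0 1%R); apply: ereal_sup_ubound; exists 1%R => //=; rewrite ltr01.
Qed.

Lemma hausdorff_ge0 k A : 0 <= hausdorff k A.
Proof.
apply: (@le_trans _ _ (mu_ext (gauge k 1%R) A)).
  by apply: mu_ext_ge0 => B; exact: gauge_ge0.
by apply: ereal_sup_ubound; exists 1%R => //=; rewrite ltr01.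
Qed.

Lemma le_hausdorff k :
  {homo hausdorff k : A B / (A `<=` B)%classic >-> A <= B}.
Proof.
move=> A B AB; apply: ge_ereal_sup => _ [d d0 <-].
apply: (@le_trans _ _ (mu_ext (gauge k d) B)); first exact: le_mu_ext.
by apply: ereal_sup_ubound; exists d.
Qed.

Lemma hausdorff_sigma_subadditive k : sigma_subadditive (hausdorff k).
Proof.
move=> F; apply: ge_ereal_sup => _ [d d0 <-].
apply: (@le_trans _ _ (\sum_(i <oo) mu_ext (gauge k d) (F i))).
  by apply: mu_ext_sigma_subadditive => A; exact: gauge_ge0.
apply: lee_nneseries => i.
  by move=> _ _; apply: mu_ext_ge0 => A; exact: gauge_ge0.
by move=> _; apply: ereal_sup_ubound; exists d.
Qed.

HB.instance Definition _ k := isOuterMeasure.Build R 'rV[R]_n (hausdorff k)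
  (hausdorff0 k) (hausdorff_ge0 k) (@le_hausdorff k)
  (@hausdorff_sigma_subadditive k).

End hausdorff_measure.

Section ball_convex_bodies.
Context {R : realType} {n : nat}.
Implicit Types (K : set 'rV[R]_n) (x y u : 'rV[R]_n) (r : R).

Definition outer_unit_normals K x : set 'rV[R]_n :=
  [set u | enorm u = 1 /\ forall y, K y -> dot y u <= dot x u].

Definition outer_normal K x : 'rV[R]_n := get (outer_unit_normals K x).

(* Near x, the boundary of K is the graph t = f y of a function f on the
   hyperplane orthogonal to the normal u, through x + y - t *: u; the property
   is that f y = <y A, y> / 2 + o(|y|^2), i.e. that A is the Hessian of f
   at 0 (second-order differentiability in the sense of Aleksandrov). *)
Definition second_order_expansion K x u (A : 'M[R]_n) : Prop :=
  forall e : R, 0 < e -> exists2 d : R, 0 < d &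
    forall y (t : R), dot y u = 0 -> enorm y < d -> `|t| < d ->
      bnd K (x + y - t *: u) ->
      `|t - dot (y *m A) y / 2| <= e * enorm y ^+ 2.

(* k lists, in nondecreasing order and with multiplicity, the eigenvalues of the
   Hessian on the tangent hyperplane.  The Hessian is extended by A u = 0 to
   the whole space, whence the additional factor 'X of the characteristic
   polynomial.  A normal point has a unique outer unit normal. *)
Definition principal_curvatures K x (k : n.-1.-tuple R) : Prop :=
  sorted <=%R k /\
  exists (u : 'rV[R]_n) (A : 'M[R]_n),
    [/\ outer_unit_normals K x = [set u], A^T = A, u *m A = 0,
        second_order_expansion K x u A
      & char_poly A = 'X * \prod_(a <- k) ('X - a%:P)].

(* The boundary points at which the principal curvatures exist; their complement
   in the boundary of a convex body is a null set. *)
Definition normal_points K : set 'rV[R]_n :=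
  [set x | bnd K x /\ exists k, principal_curvatures K x k].

Definition curvature K x (i : 'I_n.-1) : R :=
  tnth (xget [tuple 0 | _ < n.-1] (principal_curvatures K x)) i.

Definition gauss_curvature K x : R := \prod_(i < n.-1) curvature K x i.

Definition Lp_exponent (p : \bar R) : R :=
  if p is q%:E then n%:R * (q - 1) / (n%:R + q) else n%:R.

(* Surface area is the (n-1)-dimensional Hausdorff measure, as a measure on its
   Caratheodory-measurable sets.  The integrand is defined almost everywhere on
   the boundary, so the integral is taken over the set where it is defined. *)
Definition Lp_relative_surface_area r K (p : \bar R) : \bar R :=
  (\int[(hausdorff n.-1 : set (caratheodory_type (@hausdorff R n n.-1)) -> _)]_(x
      in normal_points K)
    ((gauss_curvature K x `^ n.+1%:R^-1 / dot x (outer_normal K x))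
        `^ Lp_exponent p
     * \prod_(i < n.-1) (curvature K x i - r^-1) `^ n.+1%:R^-1)%R%:E)%E.

End ball_convex_bodies.

(* Main.v *)
Require Import Defs.
From mathcomp Require Import all_boot all_order all_algebra.
From mathcomp Require Import all_classical all_reals all_analysis.
From mathcomp Require Import ring lra.
From mathcomp Require Import measurable_realfun complex.

Set Implicit Arguments.
Unset Strict Implicit.
Unset Printing Implicit Defensive.

Import Order.TTheory GRing.Theory Num.Theory.
Import numFieldNormedType.Exports.

Local Open Scope classical_set_scope.
Local Open Scope ring_scope.

(* Put t = 1 / (n + p).  The exponent n (p - 1) / (n + p) equals n - n (n + 1) t,
   so the Lp-relative surface area is J t, the integral of g `^ (n - n (n + 1) t) * h
   with g = kappa `^ (1 / (n + 1)) / <x, N x> and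
   h = prod_i (kappa_i - 1 / r) `^ (1 / (n + 1)), the index p = +oo being t = 0.
   By Hoelder's inequality ln (J t) is convex in t, and both claims express that
   the slopes of a convex function from a fixed point (t = 0, respectively
   t = 1 / n) are nondecreasing.

   Hoelder's inequality needs measurable integrands with g > 0.  Positivity comes
   from ball convexity: K lies in the ball of radius r that touches it at x, so
   kappa_i >= 1 / r.  For measurability, the Hessian A at x is characterised by
   closed conditions on (x, N x, A), and a set of boundary points defined by such
   conditions is built from projections of compact sets by countable operations;
   the products of curvatures are determinants, hence continuous in (N x, A). *)

(** * Euclidean norm and continuity *)

(** Two obstacles shape the argument. The second-order expansion is a condition for every precision,
    so describing the points whose Hessian satisfies closed conditions interchanges an existential
    over matrices with a countable intersection over precisions. This is settled by bounding the
    entries of the matrix and taking a cluster point of the witnesses. The other obstacle is that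
    the integrals may be zero or infinite. Since g is positive, J vanishes for all t or for none.
    Moreover g is bounded below by a positive constant, because kappa >= r^-(n-1) and <x, N x> <= 2
    r, so J stays finite to the right of any t at which it is finite. Slopes are compared only at
    points where J is positive and finite; all other cases are decided by the conventions for 0 and
    +oo. *)

Section euclidean_norm.
Context {R : realType} {n : nat}.
Implicit Types (x y z u : 'rV[R]_n) (a : R).

Lemma dotE x y : dot x y = \sum_i x 0 i * y 0 i.
Proof. by rewrite /dot mxE; apply: eq_bigr => i _; rewrite mxE. Qed.

Lemma dotC x y : dot x y = dot y x.
Proof. by rewrite !dotE; apply: eq_bigr => i _; rewrite mulrC. Qed.

Lemma dotDl x y z : dot (x + y) z = dot x z + dot y z.
Proof. by rewrite /dot mulmxDl mxE. Qed.

Lemma dotDr x y z : dot z (x + y) = dot z x + dot z y.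
Proof. by rewrite dotC dotDl !(dotC z). Qed.

Lemma dotZl a x y : dot (a *: x) y = a * dot x y.
Proof. by rewrite /dot -scalemxAl mxE. Qed.

Lemma dotZr a x y : dot x (a *: y) = a * dot x y.
Proof. by rewrite dotC dotZl dotC. Qed.

Lemma dotNl x y : dot (- x) y = - dot x y.
Proof. by rewrite -scaleN1r dotZl mulN1r. Qed.

Lemma dotNr x y : dot x (- y) = - dot x y.
Proof. by rewrite dotC dotNl dotC. Qed.

Lemma dot0l x : dot 0 x = 0.
Proof. by rewrite /dot mul0mx mxE. Qed.

Lemma dot0r x : dot x 0 = 0.
Proof. by rewrite dotC dot0l. Qed.

Definition dotLin := (dotDl, dotDr, dotZl, dotZr, dotNl, dotNr).

Lemma dot_ge0 x : 0 <= dot x x.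
Proof. by rewrite dotE sumr_ge0// => i _; rewrite -expr2 sqr_ge0. Qed.

Lemma dot_eq0 x : dot x x = 0 -> x = 0.
Proof.
rewrite dotE => /eqP; rewrite psumr_eq0; last first.
  by move=> i _; rewrite -expr2 sqr_ge0.
move=> /allP h; apply/rowP => i; rewrite mxE; apply/eqP.
have := h i; rewrite mem_index_enum => /(_ isT)/=.
by rewrite mulf_eq0 orbb.
Qed.

Lemma enorm_ge0 x : 0 <= enorm x. Proof. exact: sqrtr_ge0. Qed.

Lemma sqr_enorm x : enorm x ^+ 2 = dot x x.
Proof. by rewrite /enorm sqr_sqrtr ?dot_ge0. Qed.

Lemma enorm_eq0 x : enorm x = 0 -> x = 0.
Proof. by move=> h; apply: dot_eq0; rewrite -sqr_enorm h expr0n. Qed.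

Lemma enorm0 : enorm (0 : 'rV[R]_n) = 0.
Proof. by rewrite /enorm dot0l sqrtr0. Qed.

Lemma enormZ a x : enorm (a *: x) = `|a| * enorm x.
Proof.
by rewrite /enorm dotZl dotZr mulrA -expr2 sqrtrM ?sqr_ge0// sqrtr_sqr.
Qed.

Lemma enormN x : enorm (- x) = enorm x.
Proof. by rewrite -scaleN1r enormZ normrN1 mul1r. Qed.

Lemma enormB x y : enorm (x - y) = enorm (y - x).
Proof. by rewrite -enormN opprB. Qed.

Lemma le_enorm a x : 0 <= a -> (enorm x <= a) = (dot x x <= a ^+ 2).
Proof. by move=> a0; rewrite -sqr_enorm ler_pXn2r// nnegrE ?enorm_ge0. Qed.

Lemma lt_enorm a x : 0 <= a -> (enorm x < a) = (dot x x < a ^+ 2).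
Proof. by move=> a0; rewrite -sqr_enorm ltr_pXn2r// nnegrE ?enorm_ge0. Qed.

Lemma cauchy_schwarz x y : dot x y <= enorm x * enorm y.
Proof.
have [->|x0] := eqVneq x 0; first by rewrite dot0l enorm0 mul0r.
have [->|y0] := eqVneq y 0; first by rewrite dot0r enorm0 mulr0.
have nx : 0 < enorm x.
  by rewrite lt_neqAle enorm_ge0 andbT eq_sym; apply: contra_neq x0 => /enorm_eq0.
have ny : 0 < enorm y.
  by rewrite lt_neqAle enorm_ge0 andbT eq_sym; apply: contra_neq y0 => /enorm_eq0.
have := dot_ge0 (enorm y *: x - enorm x *: y).
rewrite !dotLin -!sqr_enorm (dotC y x) => h.
have : 0 <= (2 * enorm x * enorm y) * (enorm x * enorm y - dot x y) by nra.
by rewrite pmulr_rge0 ?subr_ge0// !mulr_gt0.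
Qed.

Lemma ler_enormD x y : enorm (x + y) <= enorm x + enorm y.
Proof.
rewrite le_enorm ?addr_ge0 ?enorm_ge0// !dotLin (dotC y x) -!sqr_enorm.
have := cauchy_schwarz x y; nra.
Qed.

Lemma ler_enorm_dist x y z : enorm (x - z) <= enorm (x - y) + enorm (y - z).
Proof. by rewrite (le_trans _ (ler_enormD _ _))// addrA subrK. Qed.

Lemma ler_coord_enorm x i : `|x 0 i| <= enorm x.
Proof.
rewrite -(@ler_pXn2r _ 2%N)// ?nnegrE ?enorm_ge0// sqr_enorm dotE.
rewrite -normrX ger0_norm ?sqr_ge0// (bigD1 i)//= -expr2 lerDl.
by rewrite sumr_ge0// => j _; rewrite -expr2 sqr_ge0.
Qed.

Lemma ler_norm_enorm x : `|x| <= enorm x.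
Proof.
rewrite [leLHS]/Num.Def.normr /= mx_normrE; apply/bigmax_leP.
split => /= [|[i j] _ /=]; first exact: enorm_ge0.
by rewrite ord1 ler_coord_enorm.
Qed.

Lemma unit_vector_dim u : enorm u = 1 -> (0 < n)%N.
Proof.
move=> u1; rewrite lt0n; apply/eqP => n0.
move: u1 (oner_eq0 R); rewrite (_ : u = 0) ?enorm0.
  by move=> <-; rewrite eqxx.
by apply/rowP => i; have := ltn_ord i; rewrite [X in (_ < X)%N]n0 ltn0.
Qed.

Lemma dot_mulmx (A : 'M[R]_n) x y : dot (x *m A) y = dot x (y *m A^T).
Proof. by rewrite /dot trmx_mul trmxK mulmxA. Qed.

End euclidean_norm.

Section continuity.
Context {R : realType} {n : nat} {T : topologicalType}.
Implicit Types (f g : T -> 'rV[R]_n) (h k : T -> R).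

Lemma continuous_sum (I : finType) (F : I -> T -> R) :
  (forall i, continuous (F i)) -> continuous (fun t => \sum_i F i t).
Proof.
move=> cF; apply: (@continuous_big _ _ +%R 0 xpredT) => // -[a b].
exact: add_continuous.
Qed.

Lemma continuous_coord m p (A : T -> 'M[R]_(m, p)) i j : continuous A ->
  continuous (fun t => A t i j).
Proof.
move=> cA t; apply: (@continuous_comp _ _ _ A (fun M => M i j)); first exact: cA.
exact: coord_continuous.
Qed.

Lemma continuous_mul h k : continuous h -> continuous k ->
  continuous (fun t => h t * k t).
Proof. by move=> ch ck t; apply: continuousM; [exact: ch|exact: ck]. Qed.

Lemma continuous_dot f g : continuous f -> continuous g ->
  continuous (fun t => dot (f t) (g t)).
Proof.
move=> cf cg; under eq_fun do rewrite dotE.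
by apply: continuous_sum => i; apply: continuous_mul; exact: continuous_coord.
Qed.

Lemma continuous_enorm f : continuous f -> continuous (fun t => enorm (f t)).
Proof.
move=> cf t.
apply: (@continuous_comp _ _ _ (fun t => dot (f t) (f t)) Num.sqrt).
  exact: continuous_dot.
exact: sqrt_continuous.
Qed.

Lemma continuous_quadratic f (A : T -> 'M[R]_n) : continuous f -> continuous A ->
  continuous (fun t => dot (f t *m A t) (f t)).
Proof.
move=> cf cA; under eq_fun do rewrite dotE.
apply: continuous_sum => i; apply: continuous_mul; last exact: continuous_coord.
under eq_fun do rewrite mxE.
by apply: continuous_sum => j; apply: continuous_mul; exact: continuous_coord.
Qed.

Lemma closed_ler h k : continuous h -> continuous k ->
  closed [set t | h t <= k t].
Proof.
move=> ch ck.
have -> : [set t | h t <= k t] = (fun t => h t - k t) @^-1` [set x | x <= 0].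
  by apply/seteqP; split => t /=; rewrite subr_le0.
apply: preimage_closed; last exact: closed_le.
by move=> t _; apply: continuousB; [exact: ch|exact: ck].
Qed.

Lemma closed_eqr h k : continuous h -> continuous k ->
  closed [set t | h t = k t].
Proof.
move=> ch ck.
have -> : [set t | h t = k t] = [set t | h t <= k t] `&` [set t | k t <= h t].
  apply/seteqP; split => t /=; first by move=> ->.
  by move=> [? ?]; apply/le_anti/andP.
by apply: closedI; exact: closed_ler.
Qed.

Lemma open_ltr h k : continuous h -> continuous k ->
  open [set t | h t < k t].
Proof.
move=> ch ck; rewrite -[X in open X]setCK openC.
have -> : ~` [set t | h t < k t] = [set t | k t <= h t].
  by apply/seteqP; split => t /=; [move/negP; rewrite -leNgt|rewrite leNgt => /negP].
exact: closed_ler.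
Qed.

End continuity.

(** * Closed sets are Caratheodory-measurable for the Hausdorff measure *)

Section metric_outer_measure.
Context {R : realType} {n k : nat}.
Local Open Scope ereal_scope.
Implicit Types (A B X C : set 'rV[R]_n) (d e : R).

Definition separated d A B :=
  forall a b, A a -> B b -> (d <= enorm (a - b)%R)%R.

Lemma separatedS d A B A' B' : A' `<=` A -> B' `<=` B ->
  separated d A B -> separated d A' B'.
Proof. by move=> AA BB s a b /AA Aa /BB; exact: s. Qed.

Lemma le_gauge d e (A : set (all_sets 'rV[R]_n)) :
  (d <= e)%R -> gauge k e A <= gauge k d A.
Proof.
move=> de; rewrite /gauge; case: eqP => // _.
case: ifPn => le; case: ifPn => le' //; rewrite ?leey//.
by move: le; rewrite (le_trans le')// lee_fin.
Qed.

Lemma le_mu_ext_gauge d e A : (d <= e)%R ->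
  mu_ext (gauge k e) A <= mu_ext (gauge k d) A.
Proof.
move=> de; apply: le_ereal_inf_tmp => _ [F FA <-].
apply: ge_ereal_inf; exists (\sum_(i <oo) gauge k e (F i)).
  by exists F.
apply: lee_nneseries => i; first by move=> _ _; exact: gauge_ge0.
by move=> _; exact: le_gauge.
Qed.

(** A set of diameter at most [d] cannot meet both [A] and [B], so the members of a cover that meet
    [A] and those that meet [B] form two disjoint subfamilies. A member that meets both has gauge
    [+oo], and nothing is left to prove for it. *)
Lemma mu_ext_gauge_separated d e A B : (d < e)%R -> separated e A B ->
  mu_ext (gauge k d) A + mu_ext (gauge k d) B <= mu_ext (gauge k d) (A `|` B).
Proof.
move=> de sep; apply: le_ereal_inf_tmp => _ [F [mF AF] <-].
pose G (C : set 'rV[R]_n) i : set (all_sets 'rV[R]_n) :=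
  if `[< F i `&` C !=set0 >] then F i else set0.
have cover C : C `<=` A `|` B ->
    mu_ext (gauge k d) C <= \sum_(i <oo) gauge k d (G C i).
  move=> CAB; apply: ereal_inf_lbound; exists (G C) => //; split => // x Cx.
  have [i _ Fx] := AF _ (CAB _ Cx); exists i => //.
  by rewrite /G ifT//; apply/asboolP; exists x.
apply: le_trans (leeD (cover A _) (cover B _)) _ => //.
rewrite -nneseriesD; try by move=> *; exact: gauge_ge0.
apply: lee_nneseries => i; first by move=> _ _; rewrite adde_ge0// gauge_ge0.
move=> _; rewrite /G; case: asboolP => [[a [Fa Aa]]|_]; last first.
  by rewrite gauge0 add0e; case: asboolP => // _; rewrite gauge0 gauge_ge0.
case: asboolP => [[b [Fb Bb]]|_]; last by rewrite gauge0 adde0.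
rewrite {3}/gauge; case: eqP => [F0|_]; first by rewrite F0 in Fa.
rewrite ifF ?leey//; apply/negbTE; rewrite -ltNge.
apply: (@lt_le_trans _ _ e%:E); first by rewrite lte_fin.
apply: (@le_trans _ _ (enorm (a - b)%R)%:E); first by rewrite lee_fin sep.
by apply: ereal_sup_ubound; exists (a, b).
Qed.

(** The meshes for [A] and [B] vary independently, because the two suprema are taken one after the
    other. A common mesh below both and below [e] reduces to the case of a fixed mesh. *)
Lemma hausdorff_separated e A B : (0 < e)%R -> separated e A B ->
  hausdorff k A + hausdorff k B <= hausdorff k (A `|` B).
Proof.
move=> e0 sep.
have ub d1 d2 : (0 < d1)%R -> (0 < d2)%R ->
    mu_ext (gauge k d1) A + mu_ext (gauge k d2) B <= hausdorff k (A `|` B).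
  move=> d10 d20; pose d := (Num.min (Num.min d1 d2) (e / 2))%R.
  have d0 : (0 < d)%R by rewrite !lt_min d10 d20 divr_gt0.
  have dd1 : (d <= d1)%R by rewrite !ge_min lexx.
  have dd2 : (d <= d2)%R by rewrite !ge_min lexx orbT.
  have de : (d < e)%R by rewrite gt_min ltr_pdivrMr// ltr_pMr// ltr1n orbT.
  apply: le_trans (leeD (le_mu_ext_gauge A dd1) (le_mu_ext_gauge B dd2)) _.
  apply: le_trans (mu_ext_gauge_separated de sep) _.
  by apply: ereal_sup_ubound; exists d.
have [->|foo] := eqVneq (hausdorff k (A `|` B)) +oo; first by rewrite leey.
have fin : hausdorff k (A `|` B) \is a fin_num.
  by rewrite ge0_fin_numE ?hausdorff_ge0// ltey.
have finA C : C `<=` A `|` B -> hausdorff k C \is a fin_num.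
  move=> CAB; rewrite ge0_fin_numE ?hausdorff_ge0//.
  by rewrite (le_lt_trans (le_hausdorff k CAB))// ltey.
have fin2 d : (0 < d)%R -> mu_ext (gauge k d) B \is a fin_num.
  move=> d0; rewrite ge0_fin_numE ?mu_ext_ge0//; last exact: gauge_ge0.
  rewrite (@le_lt_trans _ _ (hausdorff k B))//; last first.
    by rewrite -ge0_fin_numE ?hausdorff_ge0// finA.
  by apply: ereal_sup_ubound; exists d.
rewrite -leeBrDl ?finA//; apply: ge_ereal_sup => _ [d2 d20 <-].
rewrite leeBrDl ?finA// -leeBrDr ?fin2//; apply: ge_ereal_sup => _ [d1 d10 <-].
by rewrite leeBrDr ?fin2// ub.
Qed.

Section caratheodory_criterion.
Variable C : set 'rV[R]_n.
Hypothesis cC : closed C.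

Let layer X j := [set x | X x /\ forall c, C c -> (j.+1%:R^-1 <= enorm (x - c))%R].

Let layer_incr X i j : (i <= j)%N -> layer X i `<=` layer X j.
Proof.
move=> ij x [Xx h]; split => // c /h; apply: le_trans.
by rewrite lef_pV2 ?posrE ?ltr0n// ler_nat ltnS.
Qed.

(** A point of [X] outside layer [j.+1] lies within 1 / (j + 2) of [C], while a point of layer [j]
    is at least 1 / (j + 1) away from [C]; the triangle inequality leaves the difference. *)
Let layer_setD X j :
  separated (j.+1%:R^-1 - j.+2%:R^-1) (layer X j) (X `\` layer X j.+1).
Proof.
move=> a b [Xa ha] [Xb hb].
have [c Cc bc] : exists2 c, C c & (enorm (b - c) < j.+2%:R^-1)%R.
  apply: contrapT => h; apply: hb; split => // c Cc.
  by rewrite leNgt; apply/negP => bc; apply: h; exists c.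
rewrite lerBlDr (le_trans (ha _ Cc))// (le_trans (ler_enorm_dist a b c))//.
by rewrite lerD2l ltW.
Qed.

Let bigcup_layer X : X `\` C `<=` \bigcup_j layer X j.
Proof.
move=> x [Xx nCx].
have /nbhs_ballP[e /= e0 xe] : nbhs x (~` C).
  by apply: open_nbhs_nbhs; split => //; exact: closed_openC.
have [j je] : exists j, (j.+1%:R^-1 < e)%R.
  have := @near_infty_natSinv_lt _ (PosNum e0) => -[N _ /(_ N)/= h].
  by exists N; apply: h.
exists j => //; split => // c Cc; rewrite leNgt; apply/negP => xc.
apply: (xe c) => //; rewrite mx_norm_ball /ball_/=.
by rewrite (le_lt_trans (ler_norm_enorm _))// (lt_trans xc).
Qed.

(* The layers of X at distance at least 1 / (j + 1) from C exhaust X `\` C, and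
   layers that are not adjacent are separated; so the measures of the gaps
   between successive layers are summable. *)
Lemma closed_caratheodory : (@hausdorff R n k).-caratheodory C.
Proof.
apply: le_caratheodory_measurable => X.
change (hausdorff k (X `&` C) + hausdorff k (X `&` ~` C) <= hausdorff k X).
have [->|Xoo] := eqVneq (hausdorff k X) +oo; first by rewrite leey.
have fin Y : Y `<=` X -> hausdorff k Y \is a fin_num.
  move=> YX; rewrite ge0_fin_numE ?hausdorff_ge0//.
  by rewrite (le_lt_trans (le_hausdorff k YX))// ltey.
have layerX j : layer X j `<=` X by move=> x [].
pose S j := layer X j.+1 `\` layer X j.
have step j : hausdorff k (layer X j) + hausdorff k (S j.+1) <=
    hausdorff k (layer X j.+2).
  apply: (@le_trans _ _ (hausdorff k (layer X j `|` S j.+1))); last first.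
    apply: le_hausdorff => x [|[]//]; apply: layer_incr.
    by rewrite (@leq_trans j.+1).
  apply: (@hausdorff_separated (j.+1%:R^-1 - j.+2%:R^-1)).
    by rewrite subr_gt0 ltf_pV2 ?posrE ?ltr0n// ltr_nat.
  by apply: (separatedS _ _ (layer_setD (X:=X) (j:=j))) => // x [[? ?] ?]; split.
(* [step] skips an index, so the gaps of even and of odd index telescope separately and two layers
   remain on the right. *)
have sum_le N : \sum_(0 <= j < N) hausdorff k (S j.+1) <=
    hausdorff k (layer X N) + hausdorff k (layer X N.+1).
  elim: N => [|N ih]; first by rewrite big_nil adde_ge0// hausdorff_ge0.
  rewrite big_nat_recr//= (le_trans (leeD2r _ ih))//.
  by rewrite addeAC addeC leeD2l// step.
have sum_oo : \sum_(0 <= j <oo) hausdorff k (S j.+1) < +oo.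
  apply: (@le_lt_trans _ _ (hausdorff k X + hausdorff k X)); last first.
    by rewrite lte_add_pinfty// ltey.
  apply: lime_le; first by apply: is_cvg_nneseries => *; exact: hausdorff_ge0.
  apply: nearW => N; apply: (le_trans (sum_le N)).
  by apply: leeD; exact: le_hausdorff.
have tail := nneseries_tail_cvg sum_oo (fun j _ => hausdorff_ge0 k (S j.+1)).
apply/lee_addgt0Pr => e e0.
have [N _ /(_ N (leqnn N)) tN] : \forall N \near \oo,
    \sum_(N <= j <oo) hausdorff k (S j.+1) < e%:E.
  apply: (tail [set y | y < e%:E]); apply: open_nbhs_nbhs.
  by split; [exact: open_ereal_lt_ereal|rewrite /= lte_fin].
have cover : X `&` ~` C `<=` layer X N.+1 `|` \bigcup_(j in ~` `I_N) S j.+1.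
  move=> x /bigcup_layer[j _]; elim: j => [|j ih] xj.
    by left; exact: layer_incr xj.
  have [/ih//|nj] := pselect (layer X j x).
  have [jN|Nj] := leqP j.+1 N.+1; first by left; exact: layer_incr xj.
  right; case: j {ih} xj nj Nj => [//|j] xj nj Nj.
  by exists j => //=; apply/negP; rewrite -leqNgt.
apply: (@le_trans _ _ (hausdorff k (X `&` C) + (hausdorff k (layer X N.+1) + e%:E))).
  apply: leeD2l; apply: le_trans (le_hausdorff k cover) _.
  apply: le_trans (outer_measureU2 _ _ _) _; apply: leeD2l.
  apply: le_trans (outer_measure_sigma_subadditive_tail _ _ _) _.
  exact: ltW.
rewrite addeA leeD2r//.
have sep : separated N.+2%:R^-1 (X `&` C) (layer X N.+1).
  by move=> a b [Xa Ca] [Xb h]; rewrite enormB; exact: h.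
apply: le_trans (hausdorff_separated _ sep) _; first by rewrite invr_gt0 ltr0n.
by apply: le_hausdorff => x [[]|[]].
Qed.

End caratheodory_criterion.

End metric_outer_measure.

(** * Boundary geometry of ball convex bodies *)

Section ball_convex_geometry.
Context {R : realType} {n : nat}.
Variables (r : R) (K : set 'rV[R]_n).
Hypotheses (r_gt0 : 0 < r) (K_compact : compact K) (K_ball : ball_convex r K).
Hypothesis K0 : interior K 0.
Implicit Types (x y z u c : 'rV[R]_n) (A B : 'M[R]_n) (d e s t : R).

Lemma nbhs_enormP x (D : set 'rV[R]_n) :
  nbhs x D <-> exists2 e : R, 0 < e & forall y, enorm (y - x) < e -> D y.
Proof.
split=> [|[e e0 De]].
  move=> /nbhs_ballP[e /= e0 De]; exists e => // y yx; apply: De.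
  rewrite mx_norm_ball /ball_/= distrC.
  by rewrite (le_lt_trans (ler_norm_enorm _)).
suff : nbhs x [set y | enorm (y - x) < e] by apply: filterS => y /De.
apply: open_nbhs_nbhs; split; last by rewrite /= subrr enorm0.
apply: open_ltr; last exact: cst_continuous.
apply: continuous_enorm => y; apply: continuousB; first exact: cvg_id.
exact: cst_continuous.
Qed.

Lemma continuous_enormB x : continuous (fun y => enorm (x - y)).
Proof.
apply: continuous_enorm => y; apply: continuousB; first exact: cst_continuous.
exact: cvg_id.
Qed.

Definition centers : set 'rV[R]_n := [set c | K `<=` eball c r].

Lemma body_closed : closed K.
Proof. exact: compact_closed (@norm_hausdorff _ _) K_compact. Qed.

Lemma bndE : bnd K = K `\` interior K.
Proof. by rewrite /bnd -(closure_id K).1//; exact: body_closed. Qed.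

Lemma bnd_closed : closed (bnd K).
Proof.
rewrite bndE setDE; apply: closedI; first exact: body_closed.
exact: open_closedC (open_interior _).
Qed.

Lemma bnd_compact : compact (bnd K).
Proof.
apply: (subclosed_compact bnd_closed K_compact).
by rewrite bndE; exact: subDsetl.
Qed.

Lemma centers_compact : compact centers.
Proof.
apply: bounded_closed_compact.
  exists r; split; first exact: gtr0_real.
  move=> M rM c /(_ 0 (interior_subset K0)); rewrite /eball/= sub0r enormN => cr.
  by rewrite (le_trans (ler_norm_enorm _))// (le_trans cr)// ltW.
have -> : centers = \bigcap_(y in K) [set c | enorm (y - c) <= r].
  by apply/seteqP; split => c h y /h.
apply: closed_bigI => y _.
by apply: closed_ler; [exact: continuous_enormB|exact: cst_continuous].
Qed.

Lemma centersE z : K z <-> forall c, centers c -> enorm (z - c) <= r.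
Proof. by split=> [Kz c /(_ z Kz)//|h]; rewrite K_ball => c /h. Qed.

Lemma compact_enorm_lt x (C : set 'rV[R]_n) : compact C ->
  (forall c, C c -> enorm (x - c) < r) ->
  exists2 m, m < r & forall c, C c -> enorm (x - c) <= m.
Proof.
move=> cC lt; have [C0|/set0P C0] := eqVneq C set0.
  by exists 0 => // c; rewrite C0.
have cont : {within C, continuous (fun c => enorm (x - c))}.
  by apply: continuous_subspaceT; exact: continuous_enormB.
have [c /set_mem Cc h] := compact_EVT_max C0 cC cont.
by exists (enorm (x - c)) => [|y Cy]; [exact: lt|apply: h; rewrite inE].
Qed.

(** If every center were closer to [z] than [r], compactness of [centers] would leave a uniform
    margin, and a small ball around [z] would lie in all the balls that define [K]. *)
Lemma center_notin_interior z : ~ interior K z ->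
  exists2 c, centers c & r <= enorm (z - c).
Proof.
move=> nK; apply: contrapT => nc; apply: nK.
have [c cc|m mr h] := compact_enorm_lt (x := z) centers_compact.
  by rewrite ltNge; apply/negP => h; apply: nc; exists c.
apply/nbhs_enormP; exists (r - m); first by rewrite subr_gt0.
move=> y yz; apply/centersE => c /h zc.
rewrite (le_trans (ler_enorm_dist _ z _))//.
by rewrite (le_trans (lerD (ltW yz) zc))// subrK.
Qed.

Lemma center_normal x c : K x -> centers c -> r <= enorm (x - c) ->
  outer_unit_normals K x (r^-1 *: (x - c)).
Proof.
move=> Kx cc rx.
have xr : enorm (x - c) = r by apply/le_anti; rewrite rx cc.
split=> [|y Ky].
  by rewrite enormZ xr gtr0_norm ?invr_gt0// mulVf ?gt_eqF.
rewrite -subr_ge0 -dotNl -dotDl dotZr mulr_ge0 ?invr_ge0 ?(ltW r_gt0)//.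
(* The ball about [c] contains [y] and has [x] on its sphere. Expanding
   [|(x - c) - (x - y)|^2 <= |x - c|^2] gives [|x - y|^2 <= 2 <x - c, x - y>]. *)
have := cc _ Ky; rewrite /eball/= -xr le_enorm ?enorm_ge0// sqr_enorm.
have -> : y - c = (x - c) - (x - y) by rewrite opprB [RHS]addrC addrA subrK.
have := dot_ge0 (x - y); move: (x - y) (x - c) => a b.
by rewrite !dotLin (dotC b a); lra.
Qed.

Section smooth_point.
Variables (x u : 'rV[R]_n).
Hypotheses (bx : bnd K x) (nx : outer_unit_normals K x = [set u]).

Let Kx : K x. Proof. by move: bx; rewrite bndE => -[]. Qed.

Lemma unit_normal : enorm u = 1.
Proof. by have [] : outer_unit_normals K x u by rewrite nx. Qed.

Lemma unit_normalE : dot u u = 1.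
Proof. by rewrite -sqr_enorm unit_normal expr1n. Qed.

Lemma normal_support y : K y -> dot y u <= dot x u.
Proof. have [_ h] : outer_unit_normals K x u by rewrite nx. exact: h. Qed.

Lemma support_center c : centers c -> r <= enorm (x - c) -> x - c = r *: u.
Proof.
move=> cc rx; have := center_normal Kx cc rx.
by rewrite nx => <-; rewrite scalerA divff ?gt_eqF// scale1r.
Qed.

Lemma supporting_ball : centers (x - r *: u).
Proof.
have [c cc rc] : exists2 c, centers c & r <= enorm (x - c).
  by apply: center_notin_interior; move: bx; rewrite bndE => -[].
by rewrite -(support_center cc rc) opprB addrC subrK.
Qed.

(* By uniqueness of the normal, x - r *: u is the only center at distance r from x;
   the centers away from it are, by compactness, uniformly closer than r. *)
Lemma inner_ray d : 0 < d -> exists t, [/\ 0 < t, t < d & interior K (x - t *: u)].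
Proof.
move=> d0; pose C := centers `&` [set c | dot (x - c) u <= r / 2].
have cC : compact C.
  apply: compact_closedI; first exact: centers_compact.
  apply: closed_ler; last exact: cst_continuous.
  apply: continuous_dot; last exact: cst_continuous.
  move=> y; apply: continuousB; first exact: cst_continuous.
  exact: cvg_id.
have [c [cc /= h]|m mr h] := compact_enorm_lt (x := x) cC.
  rewrite ltNge; apply/negP => /(support_center cc) xc.
  by move: h; rewrite xc dotZl unit_normalE; have := r_gt0; lra.
(* Halving puts [t] strictly below [d], below the margin [r - m] left by the centers in [C], and
   below [r], which is what the remaining centers need. *)
pose t := Num.min (Num.min d (r - m)) r / 2.
have t0 : 0 < t by rewrite divr_gt0// !lt_min d0 r_gt0 subr_gt0 mr.
have h2 a : 0 < a -> Num.min (Num.min d (r - m)) r <= a -> t < a.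
  by rewrite /t; lra.
have td : t < d by apply: h2 => //; rewrite !ge_min lexx.
have tm : t < r - m by apply: h2; rewrite ?subr_gt0// !ge_min lexx orbT.
have tr : t < r by apply: h2 => //; rewrite !ge_min lexx orbT.
exists t; split => //; apply: contrapT => /center_notin_interior[c cc].
rewrite leNgt => /negP; apply.
have -> : x - t *: u - c = (x - c) - t *: u by rewrite addrAC.
have [xc|xc] := leP (dot (x - c) u) (r / 2).
  rewrite (le_lt_trans (ler_enormD _ _))// enormN enormZ unit_normal mulr1.
  by rewrite gtr0_norm// -ltrBrDr (le_lt_trans (h _ _))//; lra.
(* For a center outside [C], [v = x - c] has [<v, u> > r / 2], whence
   [|v - t u|^2 < r^2 - t r + t^2 < r^2]. *)
have := cc _ Kx; rewrite /eball/= le_enorm ?(ltW r_gt0)// lt_enorm ?(ltW r_gt0)//.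
move: xc; move: (x - c) => v; rewrite !dotLin unit_normalE (dotC u v).
nra.
Qed.

Lemma boundary_graph d : 0 < d -> exists2 e, 0 < e &
  forall y, dot y u = 0 -> enorm y < e ->
    exists t, [/\ 0 <= t, t < d & bnd K (x + y - t *: u)].
Proof.
move=> d0; have [t1 [t10 t1d]] := inner_ray d0.
move=> /nbhs_enormP[e e0 Ke]; exists e => // y yu ye.
pose p t := x + y - t *: u.
have cp : continuous p.
  by move=> t; apply: cvgB; [exact: cvg_cst|apply: cvgZr_tmp; exact: cvg_id].
(* The lower end -1 stands for any negative number: the supporting hyperplane excludes negative [t],
   so the least parameter in [C] is the one at which the line enters [K]. *)
pose C := `[-1, t1]%classic `&` (p @^-1` K).
have cC : compact C.
  apply: compact_closedI; first exact: segment_compact.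
  by apply: preimage_closed body_closed => ? _; exact: cp.
have C0 : C !=set0.
  exists t1; split; first by rewrite /= in_itv/= lexx andbT; lra.
  apply: Ke; rewrite (_ : _ - _ = y)//.
  by apply/rowP => i; rewrite !mxE; ring.
have cid : {within C, continuous (id : R -> R)}.
  by apply: continuous_subspaceT => t; exact: cvg_id.
have [t /set_mem[/= + Kt] tmin] := compact_EVT_min C0 cC cid.
rewrite in_itv/= => /andP[t1' tt1].
have p_out s : s < 0 -> ~ K (p s).
  move=> s0 /normal_support; rewrite /p !dotLin yu unit_normalE; lra.
have t0 : 0 <= t by rewrite leNgt; apply/negP => /p_out.
exists t; split=> //; first exact: le_lt_trans t1d.
rewrite bndE; split=> // /nbhs_enormP[e' e'0 Ke'].
(* If the point at [t] were interior, the smaller [s] would still belong to [C]; the minimum with 1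
   keeps [s] above -1. *)
pose s := t - Num.min e' 1 / 2.
have [m0 me m1] : [/\ 0 < Num.min e' 1, Num.min e' 1 <= e' & Num.min e' 1 <= 1].
  by rewrite lt_min e'0 ltr01 !ge_min !lexx orbT.
have Cs : C s.
  split; first by rewrite /= in_itv/=; apply/andP; split; rewrite /s; lra.
  apply: Ke'; rewrite (_ : _ - _ = (t - s) *: u); last first.
    by apply/rowP => i; rewrite !mxE; ring.
  by rewrite enormZ unit_normal mulr1 /s opprB addrC subrK gtr0_norm; lra.
by have := tmin s (mem_set Cs); rewrite /s; lra.
Qed.

Lemma boundary_ray y d : dot y u = 0 -> 0 < d ->
  exists s t, [/\ 0 < s, s < d, `|t| < d & bnd K (x + s *: y - t *: u)].
Proof.
move=> yu d0; have [e e0 h] := boundary_graph d0.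
pose s := Num.min d (e / (enorm y + 1)) / 2.
have y1 : 0 < enorm y + 1 by rewrite ltr_wpDl// enorm_ge0.
have m0 : 0 < Num.min d (e / (enorm y + 1)) by rewrite lt_min d0 divr_gt0.
have md : Num.min d (e / (enorm y + 1)) <= d by rewrite ge_min lexx.
have me : Num.min d (e / (enorm y + 1)) * (enorm y + 1) <= e.
  by rewrite -ler_pdivlMr// ge_min lexx orbT.
have s0 : 0 < s by rewrite divr_gt0.
have sd : s < d by rewrite /s; lra.
have [||t [t0 td bt]] := h (s *: y).
- by rewrite dotZl yu mulr0.
- rewrite enormZ gtr0_norm// /s; have := enorm_ge0 y; nra.
by exists s, t; rewrite ger0_norm.
Qed.

Lemma expansion_ray A y e : second_order_expansion K x u A -> dot y u = 0 ->
  0 < e -> exists2 d, 0 < d & forall s t, 0 < s -> s < d -> `|t| < d ->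
    bnd K (x + s *: y - t *: u) ->
    `|t - s ^+ 2 * dot (y *m A) y / 2| <= e * s ^+ 2.
Proof.
move=> hA yu e0.
have y1 : 0 < enorm y + 1 by rewrite ltr_wpDl// enorm_ge0.
have [|d d0 h] := hA (e / (enorm y + 1) ^+ 2); first by rewrite divr_gt0 ?exprn_gt0.
exists (Num.min d (d / (enorm y + 1))); first by rewrite lt_min d0 divr_gt0.
move=> s t s0; rewrite !lt_min => /andP[sd sd'] /andP[td _] bt.
have /= := h (s *: y) t; rewrite dotZl yu mulr0 enormZ gtr0_norm// => /(_ erefl).
rewrite -scalemxAl dotZl dotZr [s * (s * _)]mulrA -expr2 => h'.
apply: le_trans (h' _ td bt) _.
  by move: sd'; rewrite ltr_pdivlMr// mulrDr mulr1; lra.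
rewrite mulrAC ler_pdivrMr ?exprn_gt0// -mulrA ler_pM2l//.
rewrite exprMn ler_pM2l ?exprn_gt0// ler_pXn2r ?nnegrE ?enorm_ge0 ?lerDl//.
exact: ltW.
Qed.

(** Both expansions apply to one boundary point over [s *: y] with [s] small, and the factor [s^2]
    divides out. Each error is [e / 4] and the forms enter halved, so the two values differ by at
    most [e]. *)
Lemma expansion_unique A B y :
  second_order_expansion K x u A -> second_order_expansion K x u B ->
  dot y u = 0 -> dot (y *m A) y = dot (y *m B) y.
Proof.
move=> hA hB yu; apply/eqP; rewrite -subr_eq0 -normr_le0; apply/ler_addgt0Pr => e e0.
have e4 : 0 < e / 4 by lra.
have [d1 d10 h1] := expansion_ray hA yu e4.
have [d2 d20 h2] := expansion_ray hB yu e4.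
have [|s [t [s0]]] := @boundary_ray y (Num.min d1 d2) yu.
  by rewrite lt_min d10.
rewrite !lt_min => /andP[s1 s2] /andP[t1 t2] bt.
have := h1 _ _ s0 s1 t1 bt; have := h2 _ _ s0 s2 t2 bt.
have : 0 < s ^+ 2 by rewrite exprn_gt0.
move: (s ^+ 2) (dot _ _) (dot (y *m B) y) => S a b S0.
rewrite !ler_norml => /andP[? ?] /andP[? ?]; apply/andP.
by split; rewrite -(ler_pM2l S0); lra.
Qed.

(** The boundary point over [s *: y] lies in the supporting ball, so [s^2 |y|^2 + (r - t)^2 <= r^2]
    and thus [s^2 |y|^2 <= 2 r t]. Inserting the expansion of [t] and dividing by [s^2] gives the
    bound up to [e]. *)
Lemma expansion_ge A y : second_order_expansion K x u A -> dot y u = 0 ->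
  r^-1 * dot y y <= dot (y *m A) y.
Proof.
move=> hA yu; apply/ler_addgt0Pr => e e0.
have e2 : 0 < e / 2 by lra.
have [d d0 h] := expansion_ray hA yu e2.
have [s [t [s0 sd td bt]]] := boundary_ray yu d0.
have := h _ _ s0 sd td bt.
have Kt : K (x + s *: y - t *: u) by move: bt; rewrite bndE => -[].
have := supporting_ball Kt; rewrite /eball/= le_enorm ?(ltW r_gt0)//.
have -> : x + s *: y - t *: u - (x - r *: u) = s *: y + (r - t) *: u.
  by apply/rowP => i; rewrite !mxE; ring.
rewrite !dotLin (dotC u y) yu unit_normalE => hr.
rewrite ler_norml => /andP[_ ht].
rewrite -(ler_pM2l r_gt0) mulrA divff ?gt_eqF// mul1r.
have S0 : 0 < s ^+ 2 by rewrite exprn_gt0.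
rewrite -(ler_pM2l S0).
have : r * t <= r * (e / 2 * s ^+ 2 + s ^+ 2 * dot (y *m A) y / 2).
  by rewrite ler_pM2l//; lra.
nra.
Qed.

End smooth_point.

End ball_convex_geometry.

(** * Hessians and their eigenvalues *)

Section symmetric_matrices.
Context {R : realType} {n : nat}.
Implicit Types (x y u v : 'rV[R]_n) (A B : 'M[R]_n) (a c : R).

(** Over the complex numbers the polynomial splits. An eigenvalue [z] with eigenvector [v] satisfies
    [z |v|^2 = sum_ij v_i A_ij conj(v_j)], and by symmetry of [A] the right-hand side is its own
    conjugate, so [z] is real. *)
Lemma symmetric_char_poly_split A : A^T = A ->
  exists s : seq R, char_poly A = \prod_(a <- s) ('X - a%:P).
Proof.
move=> symA; pose toC := complex.real_complex_def (Phant R).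
pose B := map_mx toC A.
have [s sE] := closed_field_poly_normal (char_poly B).
rewrite (monicP (char_poly_monic _)) scale1r in sE.
have real z : z \in s -> z \is Num.real.
  rewrite -root_prod_XsubC -sE -eigenvalue_root_char => /eigenvalueP[v vB v0].
  pose w := \sum_i `|v 0 i| ^+ 2.
  have w0 : w != 0.
    apply: contra_neq v0 => /eqP; rewrite psumr_eq0 => [/allP h|i _]; last first.
      exact: exprn_ge0.
    apply/rowP => i; rewrite mxE; apply/eqP.
    by have := h i; rewrite mem_index_enum sqrf_eq0 normr_eq0 => /(_ isT).
  have wE : z * w = \sum_i \sum_j v 0 i * B i j * (v 0 j)^*.
    rewrite exchange_big mulr_sumr; apply: eq_bigr => j _.
    rewrite normCK mulrA -mulr_suml; congr (_ * _).
    by have /rowP/(_ j) := vB; rewrite !mxE.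
  have wR : w \is Num.real.
    by rewrite realE sumr_ge0// => i _; exact: exprn_ge0.
  rewrite -(mulfK w0 z) rpred_div// CrealE wE rmorph_sum/=; apply/eqP.
  rewrite exchange_big; apply: eq_bigr => i _.
  rewrite rmorph_sum/=; apply: eq_bigr => j _.
  rewrite !rmorphM/= conjCK (_ : (B i j)^* = B i j); last first.
    by rewrite mxE; exact: complex.conjc_real.
  rewrite (_ : B i j = B j i); last by rewrite !mxE -[in RHS]symA mxE.
  by rewrite mulrC [_ * B j i in LHS]mulrC mulrA.
exists [seq complex.Re z | z <- s].
apply: (map_inj_poly (@complex.complexI R) (rmorph0 _)).
rewrite map_char_poly sE rmorph_prod/= big_map !big_seq.
apply: eq_bigr => z zs; rewrite map_polyXsubC; congr ('X - _%:P).
by apply: esym; apply: complex.RRe_real; exact: real.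
Qed.

Lemma quadratic_form_inj A B : A^T = A -> B^T = B ->
  (forall y, dot (y *m A) y = dot (y *m B) y) -> A = B.
Proof.
move=> sA sB h; apply/eqP; rewrite -subr_eq0; apply/eqP.
pose D := A - B.
have sD : D^T = D by rewrite /D linearB/= sA sB.
have q y : dot (y *m D) y = 0 by rewrite mulmxBr dotDl dotNl h subrr.
apply/row_matrixP => i; rewrite !rowE mulmx0 -/D; apply: dot_eq0.
pose y : 'rV[R]_n := delta_mx 0 i; pose z := y *m D; rewrite -/y -/z.
have zDy : dot (z *m D) y = dot z z by rewrite dot_mulmx sD.
(* The form of [D] at [y + z] expands to [2 <z, z>], and it vanishes. *)
have := q (y + z); rewrite mulmxDl !dotLin -/z (q z) zDy (q y : dot z y = 0).
by lra.
Qed.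

Lemma mulmx_kerB A x u a : u *m A = 0 -> (x - a *: u) *m A = x *m A.
Proof. by move=> uA; rewrite mulmxBl -scalemxAl uA scaler0 subr0. Qed.

Lemma tangent_quadratic_form A u y : A^T = A -> u *m A = 0 ->
  dot (y *m A) y =
  dot ((y - dot y u *: u) *m A) (y - dot y u *: u).
Proof.
move=> sA uA; rewrite (mulmx_kerB _ _ uA).
by rewrite dotDr dotNr dotZr (dot_mulmx A y u) sA uA dot0r mulr0 subr0.
Qed.

Lemma tangent_form_inj A B u : enorm u = 1 ->
  A^T = A -> u *m A = 0 -> B^T = B -> u *m B = 0 ->
  (forall y, dot y u = 0 -> dot (y *m A) y = dot (y *m B) y) -> A = B.
Proof.
move=> u1 sA uA sB uB h; apply: quadratic_form_inj => // y.
rewrite (tangent_quadratic_form y sA uA) (tangent_quadratic_form y sB uB) h//.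
by rewrite !dotLin -(sqr_enorm u) u1 expr1n mulr1 subrr.
Qed.

(** The determinant of the bordered matrix [M] is computed twice, by clearing its lower left and its
    upper right block. The factor ['X] on the left is the determinant of the second multiplier. *)
Lemma char_poly_rank1 u c : enorm u = 1 ->
  'X * char_poly (c *: (u^T *m u)) = 'X ^+ n * ('X - c%:P).
Proof.
move=> u1; rewrite /char_poly.
pose U : 'rV[{poly R}]_n := map_mx polyC u; pose C := c%:P.
have uu : U *m U^T = 1%:M.
  rewrite map_trmx -map_mxM; have -> : u *m u^T = 1%:M.
    apply/matrixP => i j; rewrite !ord1; have : dot u u = 1.
      by rewrite -sqr_enorm u1 expr1n.
    by rewrite /dot => ->; rewrite mxE.
  by rewrite map_mx1.
have -> : char_poly_mx (c *: (u^T *m u)) = 'X%:M - C *: (U^T *m U).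
  by rewrite /char_poly_mx map_mxZ map_mxM map_trmx.
pose M := block_mx 'X%:M (C *: U^T) U 1%:M : 'M[{poly R}]_(n + 1).
have d1 : \det M = \det ('X%:M - C *: (U^T *m U)).
  have : M *m block_mx 1%:M 0 (- U) 1%:M
       = block_mx ('X%:M - C *: (U^T *m U)) (C *: U^T) 0 1%:M.
    rewrite mulmx_block !mulmx1 !mulmx0 !mul1mx !add0r mulmxN -scalemxAl.
    by rewrite subrr.
  move=> /(congr1 determinant).
  by rewrite det_mulmx det_lblock det_ublock !det1 !mulr1.
have : M *m block_mx 1%:M (- C *: U^T) 0 'X%:M
     = block_mx 'X%:M 0 U ('X - C)%:M.
  rewrite mulmx_block !mulmx1 !mulmx0 !addr0 mul1mx mul_scalar_mx.
  rewrite mul_mx_scalar !scalerA mulrN scaleNr mulrC addNr.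
  by rewrite -scalemxAr uu scale_scalar_mx mulr1 addrC -raddfD.
move=> /(congr1 determinant).
rewrite det_mulmx det_lblock det_ublock det1 mul1r !det_scalar d1 expr1.
by rewrite mulrC.
Qed.

(* Replaces the eigenvalue 0 of the normal direction by c. *)
Lemma char_poly_normal_shift A u c : enorm u = 1 -> A^T = A -> u *m A = 0 ->
  'X * char_poly (A + c *: (u^T *m u)) = ('X - c%:P) * char_poly A.
Proof.
move=> u1 sA uA; set E := u^T *m u.
have AE : A *m E = 0 by rewrite mulmxA -{1}sA -trmx_mul uA trmx0 mul0mx.
(* Since [A *m E = 0], the product of X - A and X - c E has no constant term, and a factor X splits
   off. *)
have : char_poly_mx A *m char_poly_mx (c *: E)
     = 'X *: char_poly_mx (A + c *: E).
  rewrite /char_poly_mx mulmxBl mul_scalar_mx mulmxBr -map_mxM -scalemxAr AE.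
  rewrite scaler0 map_mx0 subr0 mul_mx_scalar -scalerBr map_mxD opprD addrA.
  by rewrite addrAC.
move=> /(congr1 determinant); rewrite det_mulmx detZ => h.
have := char_poly_rank1 c u1; rewrite /char_poly => h1.
have Xn : 'X^n != 0 :> {poly R} by rewrite -size_poly_gt0 size_polyXn.
apply: (mulfI Xn); rewrite mulrCA -h mulrCA h1; ring.
Qed.

(** Moving the normal eigenvalue to [c] keeps [a] as an eigenvalue and extends the lower bound [c]
    of the form from the tangent hyperplane to all vectors. Evaluated at an eigenvector for [a], the
    bound reads [c <= a]. *)
Lemma principal_curvature_ge A u c (k : seq R) a : 0 < c -> enorm u = 1 ->
  A^T = A -> u *m A = 0 ->
  (forall y, dot y u = 0 -> c * dot y y <= dot (y *m A) y) ->
  char_poly A = 'X * \prod_(b <- k) ('X - b%:P) -> a \in k -> c <= a.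
Proof.
move=> c0 u1 sA uA h kE ak.
have : root (char_poly (A + c *: (u^T *m u))) a.
  have := char_poly_normal_shift c u1 sA uA; rewrite kE mulrCA.
  have X0 : 'X != 0 :> {poly R} by rewrite polyX_eq0.
  move=> /(mulfI X0) ->; rewrite rootM -root_prod_XsubC in ak *.
  by rewrite ak orbT.
rewrite -eigenvalue_root_char => /eigenvalueP[v vB v0].
have vv : 0 < dot v v.
  rewrite lt_neqAle dot_ge0 andbT eq_sym.
  by apply: contra_neq v0 => /dot_eq0.
rewrite -(ler_pM2r vv) -(dotZl a) -vB mulmxDr dotDl.
rewrite -scalemxAr mulmxA dotZl.
rewrite (_ : dot (v *m u^T *m u) v = dot v u ^+ 2); last first.
  have -> : v *m u^T = (dot v u)%:M by apply/matrixP => i j; rewrite !ord1 [RHS]mxE.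
  by rewrite mul_scalar_mx dotZl dotC expr2.
rewrite (tangent_quadratic_form v sA uA).
have uu : dot u u = 1 by rewrite -sqr_enorm u1 expr1n.
have wu : dot (v - dot v u *: u) u = 0 by rewrite !dotLin uu mulr1 subrr.
have ww : dot (v - dot v u *: u) (v - dot v u *: u) = dot v v - dot v u ^+ 2.
  by rewrite !dotLin uu (dotC u v); ring.
by have := h _ wu; rewrite ww; lra.
Qed.

End symmetric_matrices.

Section determinants.
Context {R : realType} {n : nat} {T : topologicalType}.

Lemma continuous_prod (I : finType) (F : I -> T -> R) :
  (forall i, continuous (F i)) -> continuous (fun t => \prod_i F i t).
Proof.
move=> cF; apply: (@continuous_big R I (@GRing.mul R) 1 xpredT) => // -[a b].
exact: mul_continuous.
Qed.

Lemma continuous_det (M : T -> 'M[R]_n) :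
  (forall i j, continuous (fun t => M t i j)) -> continuous (fun t => \det (M t)).
Proof.
move=> cM; rewrite /determinant; apply: continuous_sum => s.
apply: continuous_mul; first exact: cst_continuous.
by apply: continuous_prod => i; exact: cM.
Qed.

Lemma continuous_mx m p (M : T -> 'M[R]_(m, p)) :
  (forall i j, continuous (fun t => M t i j)) -> continuous M.
Proof.
move=> cM t; apply/cvg_ballP => e e0.
have h : \forall s \near t, forall ij : 'I_m * 'I_p,
    ball (M t ij.1 ij.2) e (M s ij.1 ij.2).
  apply: filter_forall => ij.
  by have /cvg_ballP/(_ e e0) := cM ij.1 ij.2 t.
by apply: filterS h => s h; split => // i j; exact: (h (i, j)).
Qed.

End determinants.

Section matrices.
Context {R : realType} {n : nat}.
Implicit Types (A : 'M[R]_n) (u : 'rV[R]_n).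

Definition mx_box (m : R) : set 'M[R]_n := [set A | forall i j, `|A i j| <= m].

Lemma mx_box_compact m : compact (mx_box m).
Proof.
have -> : mx_box m =
    vec_mx @` [set v : 'rV[R]_(n * n) | forall i, v 0 i \in `[- m, m]].
  apply/seteqP; split=> [A Am|_ [v vm <-] i j].
    exists (mxvec A); last by rewrite mxvecK.
    by move=> k /=; case/mxvec_indexP: k => i j; rewrite mxvecE in_itv/= -ler_norml.
  have := vm (mxvec_index i j).
  by rewrite -{1}(vec_mxK v) mxvecE in_itv/= -ler_norml.
apply: continuous_compact.
  apply: continuous_subspaceT; apply: continuous_mx => i j.
  have -> : (fun v : 'rV[R]_(n * n) => vec_mx v i j) =
      fun v => v 0 (mxvec_index i j).
    by apply/funext => v; rewrite -[v in RHS]vec_mxK mxvecE.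
  exact: coord_continuous.
apply: (@rV_compact _ _ (fun=> `[- m, m]%classic)) => _.
exact: segment_compact.
Qed.

Lemma mx_box_exists A : exists m : nat, mx_box m%:R A.
Proof.
have [m hm] : exists m : nat, `|mxvec A| <= m%:R.
  by exists (Num.trunc `|mxvec A|).+1; rewrite ltW// truncnS_gt.
exists m => i j; rewrite -mxvecE; apply: le_trans hm.
rewrite [leRHS]/Num.Def.normr /= mx_normrE.
by apply: (le_bigmax _ (fun ij => `|mxvec A ij.1 ij.2|) (0, mxvec_index i j)).
Qed.

Lemma quadratic_form_box e A (y : 'rV[R]_n) : mx_box e A ->
  `|dot (y *m A) y| <= e * (n * n)%:R * enorm y ^+ 2.
Proof.
move=> Ae; rewrite dotE (le_trans (ler_norm_sum _ _ _))//.
have -> : e * (n * n)%:R * enorm y ^+ 2 = \sum_(i < n) \sum_(j < n) e * enorm y ^+ 2.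
  rewrite sumr_const sumr_const !card_ord -mulrnA -mulr_natr; ring.
apply: ler_sum => i _; rewrite mxE normrM.
rewrite (@le_trans _ _ ((\sum_j `|y 0 j * A j i|) * `|y 0 i|))//.
  by rewrite ler_wpM2r// ler_norm_sum.
rewrite mulr_suml; apply: ler_sum => j _; rewrite normrM.
have -> : e * enorm y ^+ 2 = enorm y * e * enorm y by ring.
apply: ler_pM; rewrite ?mulr_ge0//; last exact: ler_coord_enorm.
by apply: ler_pM => //; exact: ler_coord_enorm.
Qed.

Lemma horner_char_poly A a : (char_poly A).[a] = \det (a%:M - A).
Proof.
rewrite -[LHS]/(horner_eval a _) /char_poly -det_map_mx; congr (\det _).
apply/matrixP => i j; rewrite !mxE.
rewrite -[LHS]/(('X *+ (i == j) - (A i j)%:P).[a]).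
by rewrite hornerD hornerN hornerC hornerMn hornerX.
Qed.

(** The normal direction receives the eigenvalue [1 + s], so after subtraction of [s] it contributes
    the factor 1 and only the tangential eigenvalues are left. *)
Lemma det_principal_curvatures A u (k : n.-1.-tuple R) s : enorm u = 1 ->
  A^T = A -> u *m A = 0 ->
  char_poly A = 'X * \prod_(b <- k) ('X - b%:P) ->
  \det (A + (1 + s) *: (u^T *m u) - s%:M) = \prod_(b <- k) (b - s).
Proof.
move=> u1 sA uA kE.
have n0 := unit_vector_dim u1.
have := char_poly_normal_shift (1 + s) u1 sA uA; rewrite kE mulrCA.
have X0 : 'X != 0 :> {poly R} by rewrite polyX_eq0.
move=> /(mulfI X0) /(congr1 (horner^~ s)).
rewrite horner_char_poly hornerM hornerXsubC horner_prod => h.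
set B := A + _ in h *.
(* Three signs have to cancel: (-1)^n from negating the matrix, -1 from the normal factor, and
   (-1)^(n-1) from the tangential factors. *)
have -> : B - s%:M = - 1 *: (s%:M - B) by rewrite scaleN1r opprB.
rewrite detZ h (_ : s - (1 + s) = -1); last by ring.
rewrite mulrA -exprSr.
have -> : \prod_(b <- k) ('X - b%:P).[s] = (-1) ^+ n.-1 * \prod_(b <- k) (b - s).
  rewrite -[in X in _ ^+ X](size_tuple k); elim: (tval k) => [|b l ih].
    by rewrite !big_nil mulr1.
  by rewrite !big_cons ih hornerXsubC exprS; ring.
rewrite mulrA -exprD addSn -addnS (prednK n0) addnn -mul2n mulnC exprM.
by rewrite sqrr_sign mul1r.
Qed.

End matrices.

(** * Measurability of normals and Hessians *)

Section pairs.
Context {T U V : topologicalType}.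

Lemma continuous_pair (f : T -> U) (g : T -> V) :
  continuous f -> continuous g -> continuous (fun t => (f t, g t)).
Proof.
move=> cf cg t.
by apply: (@cvg_pair _ _ _ _ (nbhs (f t)) (nbhs (g t))); [exact: cf|exact: cg].
Qed.

Lemma continuous_pr1 (f : T -> U * V) :
  continuous f -> continuous (fun t => (f t).1).
Proof. by move=> cf t; apply: (cvg_comp _ _ (cf t)); exact: cvg_fst. Qed.

Lemma continuous_pr2 (f : T -> U * V) :
  continuous f -> continuous (fun t => (f t).2).
Proof. by move=> cf t; apply: (cvg_comp _ _ (cf t)); exact: cvg_snd. Qed.

Lemma continuous_id : continuous (id : T -> T).
Proof. by move=> t; exact: cvg_id. Qed.

End pairs.

Section curvature_measurability.
Context {R : realType} {n : nat}.
Variables (r : R) (K : set 'rV[R]_n).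
Hypotheses (r_gt0 : 0 < r) (K_compact : compact K) (K_ball : ball_convex r K).
Hypothesis K0 : interior K 0.
Implicit Types (x y z u : 'rV[R]_n) (A B : 'M[R]_n) (d e s t : R).

Local Notation T3 := ('rV[R]_n * 'rV[R]_n * 'M[R]_n)%type.
Local Notation H := (@hausdorff R n n.-1).
Local Notation HT := (caratheodory_type H).

Lemma closed_hausdorff_measurable (C : set 'rV[R]_n) :
  closed C -> measurable (C : set HT).
Proof. exact: closed_caratheodory. Qed.

Lemma compact_projection (V : topologicalType) (C : set ('rV[R]_n * V)) :
  compact C -> closed (fst @` C).
Proof.
move=> cC; apply: compact_closed; first exact: norm_hausdorff.
apply: continuous_compact cC; apply: continuous_subspaceT => p.
exact: cvg_fst.
Qed.

Lemma unit_sphere_compact : compact [set u : 'rV[R]_n | enorm u = 1].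
Proof.
apply: bounded_closed_compact.
  exists 1; split; first exact: real1.
  by move=> M M1 u /= u1; rewrite (le_trans (ler_norm_enorm _))// u1 ltW.
apply: closed_eqr; last exact: cst_continuous.
by apply: continuous_enorm => x; exact: cvg_id.
Qed.

Definition normal_pairs : set ('rV[R]_n * 'rV[R]_n) :=
  [set p | bnd K p.1 /\ outer_unit_normals K p.1 p.2].

Lemma normal_pairs_compact : compact normal_pairs.
Proof.
apply: (@subclosed_compact _ _ (bnd K `*` [set u | enorm u = 1])); last 2 first.
- apply: compact_setX; first exact: (bnd_compact K_compact).
  exact: unit_sphere_compact.
- by move=> [x u] [/= ? [? _]].
have c1 : continuous (fst : 'rV[R]_n * 'rV[R]_n -> _) by move=> p; exact: cvg_fst.
have c2 : continuous (snd : 'rV[R]_n * 'rV[R]_n -> _) by move=> p; exact: cvg_snd.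
have -> : normal_pairs = fst @^-1` bnd K `&` ([set p | enorm p.2 = 1] `&`
    \bigcap_(y in K) [set p | dot y p.2 <= dot p.1 p.2]).
  by apply/seteqP; split => p; [move=> [? []]|move=> [? []]].
apply: closedI.
  by apply: preimage_closed; [move=> p _; exact: c1|exact: (bnd_closed K_compact)].
apply: closedI.
  by apply: closed_eqr; [exact: continuous_enorm|exact: cst_continuous].
apply: closed_bigI => y _.
by apply: closed_ler; apply: continuous_dot => //; exact: cst_continuous.
Qed.

Definition smooth_points : set 'rV[R]_n :=
  [set x | bnd K x /\ exists u, outer_unit_normals K x = [set u]].

Lemma outer_unit_normal_exists x : bnd K x -> exists u, outer_unit_normals K x u.
Proof.
move=> bx; have [c cc rc] : exists2 c, centers r K c & r <= enorm (x - c).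
  apply: (center_notin_interior r_gt0 K_ball K0).
  by move: bx; rewrite (bndE K_compact) => -[].
exists (r^-1 *: (x - c)); apply: (center_normal r_gt0) => //.
by move: bx; rewrite (bndE K_compact) => -[].
Qed.

(** A boundary point has at least one unit normal, so it fails to be smooth exactly when two of its
    normals are at distance at least 1 / (j + 1) for some [j]. For a fixed [j] these points form the
    projection of a compact set. *)
Lemma smooth_points_measurable : measurable (smooth_points : set HT).
Proof.
pose far j : set ('rV[R]_n * ('rV[R]_n * 'rV[R]_n)) :=
  [set p | [/\ normal_pairs (p.1, p.2.1), normal_pairs (p.1, p.2.2) &
    j.+1%:R^-1 <= enorm (p.2.1 - p.2.2)]].
have -> : smooth_points = bnd K `\` \bigcup_j (fst @` far j).
  apply/seteqP; split=> [x [bx [u xu]]|x [bx nx]].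
    split=> // -[j _ [[y [v w]] [[/= _ yv] [/= _ yw] /= vw] /= yx]].
    move: yv yw; rewrite yx xu => vu wu; move: vw.
    by rewrite vu wu subrr enorm0 leNgt invr_gt0 ltr0n.
  split=> //; have [u xu] := outer_unit_normal_exists bx.
  exists u; apply/seteqP; split=> [v xv|_ -> //].
  apply: contrapT => /eqP vu; apply: nx.
  have vu0 : 0 < enorm (v - u).
    rewrite lt_neqAle enorm_ge0 andbT eq_sym.
    by apply: contra_neq vu => /enorm_eq0/eqP; rewrite subr_eq0 => /eqP.
  have [j _ /(_ j (leqnn j)) hj] := near_infty_natSinv_lt (PosNum vu0).
  by exists j => //; exists (x, (v, u)) => //=; split => //; exact: ltW.
apply: measurableD; first exact/closed_hausdorff_measurable/(bnd_closed K_compact).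
apply: bigcupT_measurable => j; apply: closed_hausdorff_measurable.
apply: compact_projection.
pose S := [set u : 'rV[R]_n | enorm u = 1].
apply: (@subclosed_compact _ _ (bnd K `*` (S `*` S))); last 2 first.
- apply: compact_setX; first exact: (bnd_compact K_compact).
  by apply: compact_setX; exact: unit_sphere_compact.
- by move=> [x [u v]] [[/= ? [? _]] [/= ? [? _]] _].
have c1 : continuous (fun p : 'rV[R]_n * ('rV[R]_n * 'rV[R]_n) => p.1).
  exact: continuous_pr1 continuous_id.
have c2 : continuous (fun p : 'rV[R]_n * ('rV[R]_n * 'rV[R]_n) => p.2.1).
  exact: continuous_pr1 (continuous_pr2 continuous_id).
have c3 : continuous (fun p : 'rV[R]_n * ('rV[R]_n * 'rV[R]_n) => p.2.2).
  exact: continuous_pr2 (continuous_pr2 continuous_id).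
have cN := compact_closed (@norm_hausdorff _ _) normal_pairs_compact.
have -> : far j = ((fun p => (p.1, p.2.1)) @^-1` normal_pairs) `&`
    (((fun p => (p.1, p.2.2)) @^-1` normal_pairs) `&`
     [set p | j.+1%:R^-1 <= enorm (p.2.1 - p.2.2)]).
  by apply/seteqP; split => p; [case|case=> ? []].
apply: closedI.
  by apply: preimage_closed => // p _; exact: (continuous_pair c1 c2).
apply: closedI.
  by apply: preimage_closed => // p _; exact: (continuous_pair c1 c3).
apply: closed_ler; first exact: cst_continuous.
by apply: continuous_enorm => p; apply: cvgB; [exact: c2|exact: c3].
Qed.

End curvature_measurability.

(** * Points whose Hessian satisfies closed conditions *)

Section hessian_measurability.
Context {R : realType} {n : nat}.
Variables (r : R) (K : set 'rV[R]_n).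
Hypotheses (r_gt0 : 0 < r) (K_compact : compact K) (K_ball : ball_convex r K).
Hypothesis K0 : interior K 0.
Implicit Types (x y z u : 'rV[R]_n) (A B : 'M[R]_n) (d e s t : R).

Local Notation T3 := ('rV[R]_n * ('rV[R]_n * 'M[R]_n))%type.
Local Notation H := (@hausdorff R n n.-1).
Local Notation HT := (caratheodory_type H).
Implicit Types C : set T3.

Definition is_hessian x u A : Prop :=
  [/\ bnd K x, outer_unit_normals K x = [set u], A^T = A, u *m A = 0
    & second_order_expansion K x u A].

Definition hessian_locus C : set 'rV[R]_n :=
  [set x | exists u A, is_hessian x u A /\ C (x, (u, A))].

(* The defining property of [second_order_expansion] at z = x + y - t *: u, stated
   for (x, (u, A)) as a disjunction of conditions that are closed in (x, (u, A)). *)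
Definition osculating e d : set T3 := [set p | forall z, bnd K z ->
  let t := dot (p.1 - z) p.2.1 in let y := z - p.1 + t *: p.2.1 in
  d <= enorm y \/ d <= `|t| \/ `|t - dot (y *m p.2.2) y / 2| <= e * enorm y ^+ 2].

Lemma second_order_expansionP x u A : enorm u = 1 ->
  second_order_expansion K x u A <->
  forall e, 0 < e -> exists2 d, 0 < d & osculating e d (x, (u, A)).
Proof.
move=> u1; have uu : dot u u = 1 by rewrite -sqr_enorm u1 expr1n.
split=> h e /h[d d0 hd]; exists d => //.
  move=> z bz /=; set t := dot _ _; set y := z - x + _.
  have [yd|] := ltP (enorm y) d; last by left.
  have [td|] := ltP `|t| d; last by right; left.
  right; right; apply: hd => //.
    by rewrite /y dotDl dotZl uu mulr1 /t -dotDl addrA subrK subrr dot0l.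
  by rewrite (_ : _ - _ = z)//; apply/rowP => i; rewrite !mxE; ring.
move=> y t yu yd td /hd/=.
rewrite (_ : dot _ u = t); last by rewrite !dotLin uu yu; ring.
rewrite (_ : _ + t *: u = y); last by apply/rowP => i; rewrite !mxE; ring.
by rewrite leNgt yd /= leNgt td => -[|[]].
Qed.

Lemma osculating_le e1 e2 d p : e1 <= e2 -> osculating e1 d p -> osculating e2 d p.
Proof.
move=> e12 h z /h/= [|[|le]]; [by left|by right; left|right; right].
by rewrite (le_trans le)// ler_wpM2r// sqr_ge0.
Qed.

Lemma osculating_radius e d1 d2 p :
  d2 <= d1 -> osculating e d1 p -> osculating e d2 p.
Proof.
move=> d12 h z /h/= [|[|le]]; last by right; right.
- by move=> le; left; exact: le_trans le.
- by move=> le; right; left; exact: le_trans le.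
Qed.

Lemma osculating_perturb e1 e2 d x u A B : osculating e1 d (x, (u, A)) ->
  mx_box e2 (B - A) -> osculating (e1 + e2 * (n * n)%:R) d (x, (u, B)).
Proof.
move=> h BA z /h/= [|[|le]]; [by left|by right; left|right; right].
move: le; move: (dot (x - z) u) => t; move: (z - x + _) => y le.
have := quadratic_form_box y BA; rewrite mulmxBr dotDl dotNl => hq.
have q0 : 0 <= e2 * (n * n)%:R * enorm y ^+ 2 by exact: le_trans hq.
rewrite mulrDl; move: le hq q0; rewrite !ler_norml.
move: (e2 * _ * _) => E; move: (e1 * _) => E1.
by move=> /andP[? ?] /andP[? ?] ?; apply/andP; split; lra.
Qed.

Let c1 : continuous (fun p : T3 => p.1).
Proof. exact: continuous_pr1 (@continuous_id _). Qed.
Let c2 : continuous (fun p : T3 => p.2.1).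
Proof. exact: continuous_pr1 (continuous_pr2 (@continuous_id _)). Qed.
Let c3 : continuous (fun p : T3 => p.2.2).
Proof. exact: continuous_pr2 (continuous_pr2 (@continuous_id _)). Qed.

Lemma osculating_closed e d : closed (osculating e d).
Proof.
pose t z (p : T3) := dot (p.1 - z) p.2.1.
pose y z (p : T3) := z - p.1 + t z p *: p.2.1.
have -> : osculating e d = \bigcap_(z in bnd K)
    ([set p | d <= enorm (y z p)] `|` ([set p | d <= `|t z p|] `|`
    [set p | `|t z p - dot (y z p *m p.2.2) (y z p) / 2|
             <= e * enorm (y z p) ^+ 2])).
  by apply/seteqP; split => p h z bz; exact: h.
apply: closed_bigI => z _.
have ct : continuous (t z).
  by apply: continuous_dot => // p; apply: cvgB; [exact: c1|exact: cvg_cst].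
have cy : continuous (y z).
  move=> p; apply: cvgD; first by apply: cvgB; [exact: cvg_cst|exact: c1].
  by apply: cvgZ; [exact: ct|exact: c2].
apply: closedU.
  by apply: closed_ler; [exact: cst_continuous|exact: continuous_enorm].
apply: closedU.
  apply: closed_ler; first exact: cst_continuous.
  by move=> p; apply: cvg_norm; exact: ct.
apply: closed_ler.
  move=> p; apply: cvg_norm; apply: cvgB; first exact: ct.
  by apply: cvgMr_tmp; exact: (continuous_quadratic cy c3).
apply: continuous_mul; first exact: cst_continuous.
by apply: continuous_mul; exact: continuous_enorm.
Qed.

(** Only the closed conditions on a Hessian triple are collected here. Uniqueness of the normal is
    not closed under limits of boundary points; it is supplied by [smooth_points]. *)
Definition frames : set T3 := [set p |
  [/\ normal_pairs K (p.1, p.2.1), p.2.2^T = p.2.2 & p.2.1 *m p.2.2 = 0]].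

Lemma frames_closed : closed frames.
Proof.
have cN := compact_closed (@norm_hausdorff _ _) (normal_pairs_compact K_compact).
have -> : frames = ((fun p => (p.1, p.2.1)) @^-1` normal_pairs K) `&`
    ((\bigcap_(ij in [set: 'I_n * 'I_n])
       [set p : T3 | p.2.2 ij.2 ij.1 = p.2.2 ij.1 ij.2]) `&`
     (\bigcap_(j in [set: 'I_n])
       [set p : T3 | \sum_i p.2.1 0 i * p.2.2 i j = 0])).
  apply/seteqP; split=> p.
    move=> [np sp kp]; split=> //; split=> [[i j] _|j _] /=.
      by rewrite -[in RHS]sp mxE.
    by have /rowP/(_ j) := kp; rewrite !mxE.
  move=> [np [sp kp]]; split=> //.
    by apply/matrixP => i j; rewrite mxE; exact: (sp (i, j)).
  by apply/rowP => j; rewrite !mxE; exact: kp.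
apply: closedI.
  by apply: preimage_closed => // p _; exact: (continuous_pair c1 c2).
apply: closedI; apply: closed_bigI.
  by move=> ij _; apply: closed_eqr; exact: continuous_coord.
move=> j _; apply: closed_eqr; last exact: cst_continuous.
by apply: continuous_sum => i; apply: continuous_mul; exact: continuous_coord.
Qed.

Definition box_frames (m : nat) : set T3 := frames `&` [set p | mx_box m%:R p.2.2].

Lemma box_frames_compact m : compact (box_frames m).
Proof.
have cB : closed (@mx_box R n m%:R).
  exact: compact_closed (@norm_hausdorff _ _) (@mx_box_compact _ _ _).
apply: (@subclosed_compact _ _
    (bnd K `*` ([set u | enorm u = 1] `*` @mx_box R n m%:R))); last 2 first.
- apply: compact_setX; first exact: (bnd_compact K_compact).
  apply: compact_setX; [exact: unit_sphere_compact|exact: mx_box_compact].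
- by move=> [x [u A]] [[[/= ? [? _]] _ _] ?].
apply: closedI; first exact: frames_closed.
by apply: preimage_closed => // p _; exact: c3.
Qed.

(** On the right the matrix may change with the precision [k]. Compactness of the box yields a
    cluster point [A] of these witnesses. It inherits the closed conditions, and its expansion up to
    [e] comes from a witness near [A] that is precise enough. *)
Lemma hessian_locus_box C m : closed C ->
  hessian_locus (C `&` [set p | mx_box m%:R p.2.2]) = smooth_points K `&`
  \bigcap_(k in [set: nat]) \bigcup_(j in [set: nat])
    (fst @` (box_frames m `&` (C `&` osculating k.+1%:R^-1 j.+1%:R^-1))).
Proof.
move=> cC; apply/seteqP; split=> [x|x].
  move=> [u [A [[bx nx sA uA hA] [Cx Am]]]].
  have nu : outer_unit_normals K x u by rewrite nx.
  split; first by split=> //; exists u.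
  move=> k _; have [|d d0 hd] := (second_order_expansionP x A nu.1).1 hA k.+1%:R^-1.
    by rewrite invr_gt0 ltr0n.
  have [j _ /(_ j (leqnn j)) jd] := near_infty_natSinv_lt (PosNum d0).
  exists j => //; exists (x, (u, A)) => //; do 2 split => //.
  exact: osculating_radius (ltW jd) hd.
move=> [[bx [u nx]] hk].
have nu : outer_unit_normals K x u by rewrite nx.
have /choice[F hF] : forall k : nat, exists Aj : 'M[R]_n * nat,
    box_frames m (x, (u, Aj.1)) /\ C (x, (u, Aj.1)) /\
    osculating k.+1%:R^-1 Aj.2.+1%:R^-1 (x, (u, Aj.1)).
  move=> k; have [j _ [[x' [v A]] [bf [CA oA]] /= xx]] := hk k I.
  move: bf CA oA; rewrite xx => bf CA oA.
  have vu : v = u by have := bf.1; case=> -[/= _]; rewrite nx => ->.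
  by exists (A, j); rewrite -vu.
have [A [Am clA]] : mx_box m%:R `&` cluster ((fst \o F) @ \oo) !=set0.
  apply: mx_box_compact.
  by exists 0%N => // k _ /=; have [[_ /=]] := hF k.
have inA (D : set 'M[R]_n) : closed D -> (forall k, D (F k).1) -> D A.
  move=> cD hD; apply: cD => N /clA; apply.
  by exists 0%N => // k _; exact: hD.
have cxu : continuous (fun B : 'M[R]_n => (x, (u, B)) : T3).
  apply: continuous_pair; first exact: cst_continuous.
  by apply: continuous_pair; [exact: cst_continuous|exact: continuous_id].
have [_ sA uA] : frames (x, (u, A)).
  apply: (inA ((fun B => (x, (u, B))) @^-1` frames)).
    by apply: preimage_closed frames_closed => p _; exact: cxu.
  by move=> k; have [[]] := hF k.
exists u, A; split; last first.
  split=> //; apply: (inA ((fun B => (x, (u, B))) @^-1` C)).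
    by apply: preimage_closed cC => p _; exact: cxu.
  by move=> k; have [_ []] := hF k.
split=> //; apply/(second_order_expansionP _ _ nu.1) => e e0.
(* Replacing the witness by [A] costs at most [e' * n^2], which this choice keeps below [e / 2]; the
   other half of [e] pays for the precision 1 / (k + 1) of the witness. *)
pose e' := e / 2 / ((n * n)%:R + 1).
have n1 : 0 < (n * n)%:R + 1 :> R by rewrite ltr_wpDl.
have e'0 : 0 < e' by rewrite !divr_gt0.
have e2 : 0 < e / 2 by rewrite divr_gt0.
have [N _ hN] := near_infty_natSinv_lt (PosNum e2).
have [_ [[k /= Nk <-] Bk]] : [set (F k).1 | k in [set k | (N <= k)%N]] `&`
    ball A e' !=set0.
  apply: clA; last exact: nbhsx_ballx.
  by exists N => // k Nk; exists k.
exists (F k).2.+1%:R^-1; first by rewrite invr_gt0 ltr0n.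
have [_ [_ oF]] := hF k.
have : osculating (k.+1%:R^-1 + e' * (n * n)%:R) (F k).2.+1%:R^-1 (x, (u, A)).
  apply: osculating_perturb oF _ => i j.
  by rewrite !mxE; have [_ /(_ i j)] := Bk; rewrite /ball/= => /ltW.
apply: osculating_le; rewrite [leRHS]splitr lerD//.
  by apply: ltW; exact: hN k Nk.
by rewrite /e' -mulrA ler_piMr// ?(ltW e2)// mulrC ler_pdivrMr// mul1r lerDl.
Qed.

Lemma hessian_locus_measurable C : closed C ->
  measurable (hessian_locus C : set HT).
Proof.
move=> cC.
have -> : hessian_locus C =
    \bigcup_m hessian_locus (C `&` [set p | mx_box m%:R p.2.2]).
  apply/seteqP; split=> [x [u [A [hA CA]]]|x [m _ [u [A [hA [CA _]]]]]].
    have [m Am] := mx_box_exists A; exists m => //; exists u, A.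
    by split => //; split.
  by exists u, A; split.
apply: bigcupT_measurable => m; rewrite hessian_locus_box//.
apply: measurableI.
  exact: (smooth_points_measurable r_gt0 K_compact K_ball K0).
apply: bigcapT_measurable => k; apply: bigcupT_measurable => j.
apply: closed_hausdorff_measurable; apply: compact_projection.
apply: compact_closedI; first exact: box_frames_compact.
by apply: closedI => //; exact: osculating_closed.
Qed.

(** The rays [[a, +oo[] generate the Borel sets and pull back to the loci of the closed sets
    [F >= a]. Continuity is asked of [F] in the triple; [f] itself need not be continuous in [x]. *)
Lemma hessian_measurable_fun (F : T3 -> R) (f : 'rV[R]_n -> R) :
  continuous F ->
  (forall x u A, is_hessian x u A -> f x = F (x, (u, A))) ->
  measurable_fun (hessian_locus setT : set HT) (f : HT -> R).
Proof.
move=> cF hf mD; apply: (measurability (@RGenCInfty.G R)).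
  exact: RGenCInfty.measurableE.
move=> _ [_ [a ->] <-].
rewrite (_ : _ `&` _ = hessian_locus [set p | a <= F p]).
  by apply: hessian_locus_measurable; apply: closed_ler => //; exact: cst_continuous.
apply/seteqP; split=> [x [[u [A [hA _]]]]|x [u [A [hA Fa]]]].
  rewrite /= in_itv/= andbT => fa; exists u, A; split => //=.
  by rewrite -(hf _ _ _ hA).
split; first by exists u, A.
by rewrite /= in_itv/= andbT (hf _ _ _ hA).
exact: mD.
Qed.

End hessian_measurability.

(** * Curvatures and normals as measurable functions *)

Section curvature_functions.
Context {R : realType} {n : nat}.
Variables (r : R) (K : set 'rV[R]_n).
Hypotheses (r_gt0 : 0 < r) (K_compact : compact K) (K_ball : ball_convex r K).
Hypothesis K0 : interior K 0.
Implicit Types (x y z u : 'rV[R]_n) (A B : 'M[R]_n).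

Local Notation H := (@hausdorff R n n.-1).
Local Notation HT := (caratheodory_type H).

Lemma outer_normalE x u : outer_unit_normals K x = [set u] -> outer_normal K x = u.
Proof.
move=> xu; have : outer_unit_normals K x (outer_normal K x).
  by apply: getPex; exists u; rewrite xu.
by rewrite xu.
Qed.

Lemma dot_normal_gt0 x u : outer_unit_normals K x u -> 0 < dot x u.
Proof.
move=> [u1 hu]; have [e e0 Ke] := (nbhs_enormP 0 K).1 K0.
apply: (@lt_le_trans _ _ (dot ((e / 2) *: u) u)).
  by rewrite dotZl -sqr_enorm u1 expr1n mulr1 divr_gt0.
apply: hu; apply: Ke; rewrite subr0 enormZ u1 mulr1 gtr0_norm ?divr_gt0//.
by rewrite ltr_pdivrMr// ltr_pMr// ltr1n.
Qed.

(** The supporting ball at [x] has radius [r] and contains both [x] and the origin, so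
    [|x| <= 2 r]. *)
Lemma dot_normal_le x u : bnd K x -> outer_unit_normals K x = [set u] ->
  dot x u <= r *+ 2.
Proof.
move=> bx xu; have nu : outer_unit_normals K x u by rewrite xu.
have u1 := nu.1.
have := supporting_ball r_gt0 K_compact K_ball K0 bx xu (interior_subset K0).
rewrite /eball/= sub0r opprB => hr.
rewrite (le_trans (cauchy_schwarz _ _))// u1 mulr1.
have -> : x = r *: u - (r *: u - x) by rewrite opprB addrC subrK.
rewrite (le_trans (ler_enormD _ _))// mulr2n enormN lerD//.
by rewrite enormZ u1 mulr1 gtr0_norm.
Qed.

Lemma hessian_unique x u v A B : is_hessian K x u A -> is_hessian K x v B ->
  u = v /\ A = B.
Proof.
move=> [bx xu sA uA hA] [_ xv sB vB hB].
have nu : outer_unit_normals K x u by rewrite xu.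
have uv : u = v by move: nu; rewrite xv.
split=> //; rewrite -{}uv in vB hB.
apply: (@tangent_form_inj _ _ A B u) => //.
  exact: nu.1.
by move=> y; exact: (expansion_unique r_gt0 K_compact K_ball K0 bx xu).
Qed.

(** The kernel vector [u] makes 0 an eigenvalue. Removing one copy of it from the real roots and
    sorting the rest yields the tuple, so the spectral condition in [principal_curvatures] holds as
    soon as a Hessian exists. *)
Lemma hessian_principal_curvatures x u A : is_hessian K x u A ->
  exists k, principal_curvatures K x k.
Proof.
move=> [bx xu sA uA hA].
have [u1 _] : outer_unit_normals K x u by rewrite xu.
have [s sE] := symmetric_char_poly_split sA.
have s0 : 0 \in s.
  rewrite -root_prod_XsubC -sE -eigenvalue_root_char; apply/eigenvalueP; exists u.
    by rewrite uA scale0r.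
  by apply: contra_eq_neq u1 => ->; rewrite enorm0 eq_sym oner_eq0.
pose k := sort <=%R (rem 0 s).
have sk : perm_eq s (0 :: k).
  by rewrite (perm_trans (perm_to_rem s0))// perm_cons perm_sym perm_sort.
have size_k : size k == n.-1.
  rewrite -(@eqn_add2l 1) add1n -[(size k).+1]/(size (0 :: k)) -(perm_size sk).
  have : size (char_poly A) = (size s).+1 by rewrite sE size_prod_XsubC.
  by rewrite size_char_poly => -[<-]; rewrite add1n prednK// (unit_vector_dim u1).
exists (Tuple size_k); split=> /=; first exact: sort_le_sorted.
exists u, A; split=> //; rewrite sE (perm_big _ sk) big_cons.
by rewrite subr0.
Qed.

Lemma normal_pointsE : normal_points K = hessian_locus K setT.
Proof.
apply/seteqP; split=> x.
  by move=> [bx [k [_ [u [A [xu sA uA hA _]]]]]]; exists u, A.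
move=> [u [A [hA _]]]; split; first by case: hA.
exact: hessian_principal_curvatures hA.
Qed.

Lemma hessian_curvature x u A : is_hessian K x u A ->
  exists2 k : n.-1.-tuple R, (forall i, curvature K x i = tnth k i) &
    char_poly A = 'X * \prod_(a <- k) ('X - a%:P).
Proof.
move=> hA; have := hessian_principal_curvatures hA.
move=> /(xgetPex [tuple 0 | _ < n.-1]); set k := xget _ _.
move=> [_ [v [B [xv sB vB hB kE]]]].
exists k => //; suff -> : A = B by [].
have [bx _ _ _ _] := hA.
by have [] : u = v /\ A = B by apply: hessian_unique hA _; split.
Qed.

Lemma hessian_prod_curvature x u A s : is_hessian K x u A ->
  \prod_(i < n.-1) (curvature K x i - s)
  = \det (A + (1 + s) *: (u^T *m u) - s%:M).
Proof.
move=> hA; have [k ck kE] := hessian_curvature hA.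
have [bx xu sA uA _] := hA.
have [u1 _] : outer_unit_normals K x u by rewrite xu.
rewrite (det_principal_curvatures s u1 sA uA kE) big_tuple.
by apply: eq_bigr => i _; rewrite ck.
Qed.

Lemma curvature_ge x i : normal_points K x -> r^-1 <= curvature K x i.
Proof.
rewrite normal_pointsE => -[u [A [hA _]]].
have [k -> kE] := hessian_curvature hA; have [bx xu sA uA xA] := hA.
have [u1 _] : outer_unit_normals K x u by rewrite xu.
apply: (principal_curvature_ge _ u1 sA uA _ kE); rewrite ?invr_gt0 ?mem_tnth//.
by move=> y; exact: (expansion_ge r_gt0 K_compact K_ball K0 bx xu).
Qed.

Lemma measurable_normal_points : measurable (normal_points K : set HT).
Proof.
rewrite normal_pointsE; exact: (hessian_locus_measurable r_gt0).
Qed.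

Lemma measurable_prod_curvature s : measurable_fun (normal_points K : set HT)
  (fun x : HT => \prod_(i < n.-1) (curvature K x i - s)).
Proof.
rewrite normal_pointsE; apply: (hessian_measurable_fun r_gt0 K_compact K_ball K0
  (F := fun p : 'rV[R]_n * ('rV[R]_n * 'M[R]_n) =>
     \det (p.2.2 + (1 + s) *: (p.2.1^T *m p.2.1) - s%:M))); last first.
  by move=> x u A; exact: hessian_prod_curvature.
apply: continuous_det => i j; under eq_fun do rewrite !mxE big_ord1 !mxE.
have c2 : continuous (fun p : 'rV[R]_n * ('rV[R]_n * 'M[R]_n) => p.2.1).
  exact: continuous_pr1 (continuous_pr2 (@continuous_id _)).
have c3 : continuous (fun p : 'rV[R]_n * ('rV[R]_n * 'M[R]_n) => p.2.2).
  exact: continuous_pr2 (continuous_pr2 (@continuous_id _)).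
have h2 := continuous_mul (continuous_coord (i := 0) (j := i) c2)
  (continuous_coord (i := 0) (j := j) c2).
have h3 := continuous_coord (i := i) (j := j) c3.
move=> p; apply: cvgB; last exact: cvg_cst.
apply: cvgD; first exact: h3.
by apply: cvgMl_tmp; exact: h2.
Qed.

Lemma measurable_dot_normal : measurable_fun (normal_points K : set HT)
  (fun x : HT => dot x (outer_normal K x)).
Proof.
rewrite normal_pointsE; apply: (hessian_measurable_fun r_gt0 K_compact K_ball K0
  (F := fun p : 'rV[R]_n * ('rV[R]_n * 'M[R]_n) => dot p.1 p.2.1)).
  apply: continuous_dot; first exact: continuous_pr1 (@continuous_id _).
  exact: continuous_pr1 (continuous_pr2 (@continuous_id _)).
by move=> x u A [_ xu _ _ _]; rewrite (outer_normalE xu).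
Qed.

End curvature_functions.

(** * Log-convexity of power integrals *)

Section three_slopes.
Context {R : realFieldType}.
Variables (L : R -> R) (s c w : R).

(** Convexity is assumed among three points only, since [L] will be the logarithm of an integral
    that may be infinite elsewhere. The cases differ in which of the three points is the middle
    one. *)
Lemma slope_le : s <= w -> s != c -> w != c ->
  (forall a m b, [/\ a \in [:: s; c; w], m \in [:: s; c; w] & b \in [:: s; c; w]] ->
    a < m -> m < b -> (b - a) * L m <= (b - m) * L a + (m - a) * L b) ->
  (L s - L c) / (s - c) <= (L w - L c) / (w - c).
Proof.
rewrite le_eqVlt => /predU1P[-> //|sw] sc wc cvx.
have flip a : (L a - L c) / (a - c) = (L c - L a) / (c - a).
  by rewrite -(opprB (L c)) -(opprB c) invrN mulrNN.
have i1 : s \in [:: s; c; w] by rewrite !inE eqxx.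
have i2 : c \in [:: s; c; w] by rewrite !inE eqxx orbT.
have i3 : w \in [:: s; c; w] by rewrite !inE eqxx !orbT.
have [cs|sc'|e] := ltgtP c s; last by rewrite e eqxx in sc.
  have := cvx _ _ _ (And3 i2 i1 i3) cs sw => h.
  rewrite ler_pdivrMr ?subr_gt0// mulrAC ler_pdivlMr ?subr_gt0 ?(lt_trans cs)//.
  lra.
have [cw|wc'|e] := ltgtP c w; last by rewrite e eqxx in wc.
  have := cvx _ _ _ (And3 i1 i2 i3) sc' cw => h.
  rewrite flip ler_pdivrMr ?subr_gt0// mulrAC ler_pdivlMr ?subr_gt0//.
  lra.
have := cvx _ _ _ (And3 i1 i3 i2) sw wc' => h.
rewrite !flip ler_pdivrMr ?subr_gt0// mulrAC ler_pdivlMr ?subr_gt0//.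
lra.
Qed.

End three_slopes.

(** The bound is linear in [x] and [y]. With the two integrals as [u] and [v], the last factor
    integrates to 1, which is Hoelder's inequality. *)
Lemma weighted_young {R : realType} (x y u v l : R) : 0 < l < 1 ->
  0 <= x -> 0 <= y -> 0 < u -> 0 < v ->
  x `^ (1 - l) * y `^ l <=
  u `^ (1 - l) * v `^ l * ((1 - l) * (x / u) + l * (y / v)).
Proof.
move=> /andP[l0 l1] x0 y0 u0 v0; have l1' : 0 < 1 - l by rewrite subr_gt0.
have xu : 0 <= x / u := divr_ge0 x0 (ltW u0).
have yv : 0 <= y / v := divr_ge0 y0 (ltW v0).
rewrite -{1}(divfK (lt0r_neq0 u0) x) -{1}(divfK (lt0r_neq0 v0) y).
rewrite (powRM _ xu (ltW u0)) (powRM _ yv (ltW v0)) mulrACA [leLHS]mulrC.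
rewrite ler_wpM2l ?mulr_ge0 ?powR_ge0//.
have li : 0 < l^-1 by rewrite invr_gt0.
have li' : 0 < (1 - l)^-1 by rewrite invr_gt0.
have conj : (1 - l)^-1^-1 + l^-1^-1 = 1 by rewrite !invrK subrK.
have := conjugate_powR (powR_ge0 (x / u) (1 - l)) (powR_ge0 (y / v) l) li' li conj.
rewrite -!powRrM mulfV ?(gt_eqF l1')// mulfV ?(gt_eqF l0)// !powRr1// !invrK.
by rewrite [_ * (1 - l)]mulrC [_ * l]mulrC.
Qed.

Definition power_integral d (T : measurableType d) (R : realType)
    (mu : set T -> \bar R) (D : set T) (g h : T -> R) (a : R) : \bar R :=
  (\int[mu]_(x in D) (g x `^ a * h x)%:E)%E.

Section power_integrals.
Context d (T : measurableType d) (R : realType).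
Variables (mu : {measure set T -> \bar R}) (D : set T) (g h : T -> R).
Hypotheses (mD : measurable D) (mg : measurable_fun D g) (mh : measurable_fun D h).
Hypotheses (g_gt0 : forall x, D x -> 0 < g x) (h_ge0 : forall x, D x -> 0 <= h x).
Implicit Types (a b c s t w l : R).
Local Open Scope ereal_scope.

Local Notation I := (power_integral mu D g h).

Let f_ge0 a x : D x -> 0 <= (g x `^ a * h x)%:E.
Proof. by move=> Dx; rewrite lee_fin mulr_ge0 ?powR_ge0 ?h_ge0. Qed.

Let f_meas a : measurable_fun D (fun x => (g x `^ a * h x)%:E).
Proof.
apply/measurable_EFinP; apply: measurable_funM => //.
exact: (measurableT_comp (@measurable_powR R a) mg).
Qed.

Lemma power_integral_ge0 a : 0 <= I a.
Proof. by apply: integral_ge0 => x; exact: f_ge0. Qed.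

(** As [g] is positive, the integrand vanishes almost everywhere exactly when [h] does, whatever the
    exponent. *)
Lemma power_integral_eq0 a b : I a = 0 -> I b = 0.
Proof.
move=> Ia; have ae0 : ae_eq mu D (fun x => (g x `^ a * h x)%:E) (cst 0).
  apply/(ae_eq_integral_abs mu mD (f_meas a)); rewrite -[RHS]Ia.
  by apply: eq_integral => x /set_mem Dx; rewrite gee0_abs ?f_ge0.
rewrite -(integral0 mu D); apply: ge0_ae_eq_integral => //.
  by move=> x; exact: f_ge0.
apply: filterS ae0 => x hx Dx; have [/eqP] := hx Dx.
rewrite mulf_eq0 gt_eqF ?powR_gt0 ?g_gt0//= => /eqP ->.
by rewrite mulr0.
Qed.

(** The exponent [b - a] is nonpositive, so [g^b = g^(b - a) g^a <= m^(b - a) g^a]. *)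
Lemma power_integral_lty a b : (exists2 m, 0 < m & forall x, D x -> m <= g x)%R ->
  (b <= a)%R -> I a < +oo -> I b < +oo.
Proof.
move=> [m m0 hm] ba Ia.
apply: (@le_lt_trans _ _ ((m `^ (b - a))%:E * I a)); last first.
  by rewrite lte_mul_pinfty// lee_fin powR_ge0.
rewrite -ge0_integralZl_EFin ?powR_ge0//; last by move=> x; exact: f_ge0.
apply: ge0_le_integral => //.
- by move=> x; exact: f_ge0.
- by apply: measurable_funeM.
move=> x Dx; rewrite -EFinM lee_fin mulrA ler_wpM2r ?h_ge0//.
have -> : (g x `^ b = g x `^ (b - a) * g x `^ a)%R.
  by rewrite -powRD ?subrK// (gt_eqF (g_gt0 Dx)) implybT.
rewrite ler_wpM2r ?powR_ge0//.
rewrite -(opprB a b) !powRN lef_pV2 ?posrE ?powR_gt0 ?g_gt0//.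
by apply: ge0_ler_powR; rewrite ?subr_ge0 ?nnegrE ?(ltW m0) ?(ltW (g_gt0 Dx)) ?hm.
Qed.

Lemma power_integral_le_combination a b c ca cb u v : (0 <= ca)%R -> (0 <= cb)%R ->
  I a = u%:E -> I b = v%:E ->
  (forall x, D x ->
    g x `^ c * h x <= ca * (g x `^ a * h x) + cb * (g x `^ b * h x))%R ->
  I c <= (ca * u + cb * v)%:E.
Proof.
move=> ca0 cb0 Ia Ib le_c.
have mZ k b' : measurable_fun D (fun x => k%:E * (g x `^ b' * h x)%:E).
  exact: measurable_funeM.
have Z0 k b' x : (0 <= k)%R -> D x -> 0 <= k%:E * (g x `^ b' * h x)%:E.
  by move=> k0 Dx; rewrite mule_ge0 ?f_ge0.
rewrite EFinD !EFinM -Ia -Ib /power_integral.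
rewrite -(ge0_integralZl_EFin mu mD (f_ge0 a) (f_meas a) ca0).
rewrite -(ge0_integralZl_EFin mu mD (f_ge0 b) (f_meas b) cb0).
rewrite -(ge0_integralD mu mD (fun x => Z0 ca a x ca0) (mZ ca a)
  (fun x => Z0 cb b x cb0) (mZ cb b)).
apply: (@ge0_le_integral _ _ _ mu D mD _ _ (f_ge0 c) (f_meas c)).
  by apply: emeasurable_funD; exact: mZ.
by move=> x Dx; rewrite -!EFinM -EFinD lee_fin; exact: le_c.
Qed.

Lemma power_integral_log_convex a b l u v : (0 < l < 1)%R ->
  (0 < u)%R -> (0 < v)%R -> I a = u%:E -> I b = v%:E ->
  I ((1 - l) * a + l * b) <= (u `^ (1 - l) * v `^ l)%:E.
Proof.
move=> l01 u0 v0 Ia Ib; have /andP[l0 l1] := l01.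
have l1' : (0 < 1 - l)%R by rewrite subr_gt0.
have M0 : (0 <= u `^ (1 - l) * v `^ l)%R by rewrite mulr_ge0 ?powR_ge0.
rewrite [X in X%:E](_ : _ = (u `^ (1 - l) * v `^ l * (1 - l) / u) * u +
  (u `^ (1 - l) * v `^ l * l / v) * v)%R; last first.
  by rewrite !divfK ?lt0r_neq0//; ring.
apply: power_integral_le_combination Ia Ib _.
- by apply: divr_ge0 (ltW u0); exact: mulr_ge0 M0 (ltW l1').
- by apply: divr_ge0 (ltW v0); exact: mulr_ge0 M0 (ltW l0).
move=> x Dx; have gx0 := g_gt0 Dx; have hx0 := h_ge0 Dx.
have X0 : (0 <= g x `^ a * h x)%R by rewrite mulr_ge0 ?powR_ge0.
have Y0 : (0 <= g x `^ b * h x)%R by rewrite mulr_ge0 ?powR_ge0.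
have -> : (g x `^ ((1 - l) * a + l * b) * h x =
    (g x `^ a * h x) `^ (1 - l) * (g x `^ b * h x) `^ l)%R.
  rewrite (powRM _ (powR_ge0 _ _) hx0) (powRM _ (powR_ge0 _ _) hx0) -!powRrM.
  rewrite powRD ?(gt_eqF gx0) ?implybT// (mulrC (1 - l)%R) (mulrC l) mulrACA.
  congr (_ * _)%R; rewrite -powRD ?subrK ?powRr1//.
  by rewrite oner_eq0.
apply: le_trans (weighted_young l01 X0 Y0 u0 v0) _.
by rewrite le_eqVlt; apply/orP; left; apply/eqP; ring.
Qed.

End power_integrals.

(** * Monotone roots of ratios of a log-convex function with values in [[0, +oo]] *)

Section log_convex_ratios.
Context {R : realType}.
Variable J : R -> \bar R.
Implicit Types (c l s t u v w k : R).
Local Open Scope ereal_scope.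

Hypothesis J_ge0 : forall t, 0 <= J t.
Hypothesis J_eq0 : forall s t, J s = 0 -> J t = 0.
Hypothesis J_convex : forall s w l u v, (0 < l < 1)%R -> (0 < u)%R -> (0 < v)%R ->
  J s = u%:E -> J w = v%:E ->
  J ((1 - l) * s + l * w) <= (u `^ (1 - l) * v `^ l)%:E.

Let J_gt0 s t : 0 < J s -> 0 < J t.
Proof. by rewrite !lt0e !J_ge0 !andbT; apply: contra_neq; exact: J_eq0. Qed.

Let JE t : 0 < J t < +oo -> exists2 u, (0 < u)%R & J t = u%:E.
Proof.
by case: (J t) => [u| |]; rewrite ?ltxx ?andbF// lte_fin ltry andbT; exists u.
Qed.

Let L t : R := ln (fine (J t)).

Lemma log_convex_midpoint s m w : (s < m)%R -> (m < w)%R ->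
  0 < J s < +oo -> 0 < J w < +oo ->
  J m < +oo /\ ((w - s) * L m <= (w - m) * L s + (m - s) * L w)%R.
Proof.
move=> sm mw Js Jw; have sw := lt_trans sm mw.
have ws0 : (0 < w - s)%R by rewrite subr_gt0.
have [l l01 lE] : exists2 l, (0 < l < 1)%R & (l * (w - s) = m - s)%R.
  exists ((m - s) / (w - s))%R; last by rewrite divfK// gt_eqF.
  by rewrite divr_gt0 ?subr_gt0//= ltr_pdivrMr// mul1r ltrD2r.
have [u u0 uE] := JE Js; have [v v0 vE] := JE Jw.
have := J_convex l01 u0 v0 uE vE.
rewrite (_ : (1 - l) * s + l * w = m)%R; last by rewrite -[RHS](subrK s m) -lE; ring.
move=> Jle; have Jm : J m < +oo by rewrite (le_lt_trans Jle)// ltry.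
split=> //.
have [|m' m'0 mE] := @JE m; first by rewrite Jm andbT (@J_gt0 s); case/andP: Js.
move: Jle; rewrite /L mE uE vE/= lee_fin => Jle.
have Lle : (ln m' <= (1 - l) * ln u + l * ln v)%R.
  rewrite -!ln_powR -lnM ?posrE ?powR_gt0//.
  by rewrite ler_ln ?posrE ?mulr_gt0 ?powR_gt0.
have -> : ((w - m) * ln u + (m - s) * ln v =
    (w - s) * ((1 - l) * ln u + l * ln v))%R.
  have -> : (w - m = (w - s) - (m - s))%R by ring.
  by rewrite -lE; ring.
by rewrite ler_pM2l.
Qed.

Lemma log_convex_slope_le s c w : (s <= w)%R -> s != c -> w != c ->
  0 < J s < +oo -> 0 < J c < +oo -> 0 < J w < +oo ->
  ((L s - L c) / (s - c) <= (L w - L c) / (w - c))%R.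
Proof.
move=> sw sc wc Js Jc Jw; apply: slope_le => // a m b [ia im ib] am mb.
have fin t : t \in [:: s; c; w] -> 0 < J t < +oo.
  by rewrite !inE => /or3P[] /eqP ->.
by have [] := log_convex_midpoint am mb (fin _ ia) (fin _ ib).
Qed.

Lemma ratio_poweR s c k : 0 < J s < +oo -> 0 < J c < +oo ->
  (J s / J c) `^ k = (expR (k * (L s - L c)))%:E.
Proof.
move=> /JE[u u0 uE] /JE[v v0 vE]; rewrite /L uE vE inver gt_eqF// -EFinM.
by rewrite poweR_EFin /powR gt_eqF ?divr_gt0// ln_div.
Qed.

(** If [J c = 0] then [J s = 0] as well, and if [J c = +oo] its inverse is 0. The ratio is 0 either
    way, and the comparisons below then read [0 <= 0]. *)
Lemma ratio_poweR_degenerate s c k : k != 0%R -> ~~ (0 < J c < +oo) ->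
  (J s / J c) `^ k = 0.
Proof.
move=> k0; rewrite negb_and -!leNgt leye_eq => /orP[Jc|/eqP ->].
  have /J_eq0 -> : J c = 0 by apply/le_anti; rewrite Jc J_ge0.
  by rewrite mul0e poweR0r.
by rewrite invey mule0 poweR0r.
Qed.

Lemma ratio_poweR_pinfty s c k : 0 < J c < +oo -> J s = +oo -> k != 0%R ->
  (J s / J c) `^ k = +oo.
Proof.
move=> /JE[v v0 ->] -> k0.
by rewrite inver gt_eqF// mulyr gtr0_sg ?invr_gt0// mul1e poweRyr.
Qed.

Lemma ratio_root_le s w : (0 < s)%R -> (s <= w)%R ->
  (J s / J 0) `^ s^-1 <= (J w / J 0) `^ w^-1.
Proof.
move=> s0 sw; have w0 := lt_le_trans s0 sw.
have [Jc|/ratio_poweR_degenerate deg] := boolP (0 < J 0 < +oo); last first.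
  by rewrite !deg ?invr_eq0 ?gt_eqF.
have Jpos t : 0 < J t by apply: (@J_gt0 0); case/andP: Jc.
(* If [J w] is infinite, the right-hand side is [+oo]; otherwise log-convexity between 0 and [w]
   makes [J s] finite. *)
have [Jw|Jw] := eqVneq (J w) +oo.
  by rewrite [leRHS]ratio_poweR_pinfty ?leey ?invr_eq0 ?gt_eqF.
have Jw' : 0 < J w < +oo by rewrite Jpos ltey.
have Js' : 0 < J s < +oo.
  rewrite Jpos/=; move: sw; rewrite le_eqVlt => /predU1P[->|sw].
    by rewrite ltey.
  by have [] := log_convex_midpoint s0 sw Jc Jw'.
rewrite !ratio_poweR// lee_fin ler_expR.
have := log_convex_slope_le sw (lt0r_neq0 s0) (lt0r_neq0 w0) Js' Jc Jw'.
by rewrite !subr0 ![(_ * _^-1)%R]mulrC.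
Qed.

(* As [+oo `^ k = +oo] also for negative [k], finiteness beyond [c] has to be
   assumed. *)
Lemma ratio_root_ge s c w k : (0 < k)%R -> (s <= w)%R -> s != c -> w != c ->
  (forall t, (c < t)%R -> J c < +oo -> J t < +oo) ->
  (J w / J c) `^ (k / (c - w)) <= (J s / J c) `^ (k / (c - s)).
Proof.
move=> k0 sw sc wc fin.
have e0 t : t != c -> (k / (c - t) != 0)%R.
  by move=> tc; rewrite mulf_neq0 ?(lt0r_neq0 k0)// invr_eq0 subr_eq0 eq_sym.
have [Jc|/ratio_poweR_degenerate deg] := boolP (0 < J c < +oo); last first.
  by rewrite !deg// e0.
have Jpos t : 0 < J t by apply: (@J_gt0 c); case/andP: Jc.
have [Js|Js] := eqVneq (J s) +oo.
  by rewrite [leRHS]ratio_poweR_pinfty ?leey ?e0.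
have Js' : 0 < J s < +oo by rewrite Jpos ltey.
have Jw' : 0 < J w < +oo.
  (* To the right of [c] finiteness is the hypothesis [fin]; to the left, [w] either equals [s] or
     lies between [s] and [c], where log-convexity applies. *)
  rewrite Jpos/=; have [cw|wc'|e] := ltgtP c w; last by rewrite e eqxx in wc.
    by apply: fin cw _; case/andP: Jc.
  move: sw; rewrite le_eqVlt => /predU1P[<-|sw]; first by rewrite ltey.
  by have [] := log_convex_midpoint sw wc' Js' Jc.
rewrite !ratio_poweR// lee_fin ler_expR.
have := log_convex_slope_le sw sc wc Js' Jc Jw'.
(* [k / (c - t)] is the negative of [k / (t - c)], which turns increasing slopes into decreasing
   powers. *)
rewrite -(opprB s c) -(opprB w c) !invrN !mulrN !mulNr lerN2 -!mulrA.
by rewrite ler_pM2l// ![(_^-1 * _)%R]mulrC.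
Qed.

End log_convex_ratios.

(** * The Lp-relative surface areas *)

Section integrands.
Context {R : realType} {n : nat}.
Variables (r : R) (K : set 'rV[R]_n).
Hypotheses (r_gt0 : 0 < r) (K_compact : compact K) (K_ball : ball_convex r K).
Hypothesis K0 : interior K 0.
Implicit Types x : 'rV[R]_n.

Local Notation H := (@hausdorff R n n.-1).
Local Notation HT := (caratheodory_type H).

(* [hausdorff] under the types for which the Caratheodory measure structure is
   inferred. *)
Definition surface_outer_measure : {outer_measure set 'rV[R]_n -> \bar R} :=
  hausdorff n.-1.

Definition surface_measure :
    {measure set (caratheodory_type surface_outer_measure) -> \bar R} :=
  (surface_outer_measure : set (caratheodory_type surface_outer_measure) -> \bar R).

Definition curvature_ratio x : R :=
  gauss_curvature K x `^ n.+1%:R^-1 / dot x (outer_normal K x).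

Definition curvature_weight x : R :=
  \prod_(i < n.-1) (curvature K x i - r^-1) `^ n.+1%:R^-1.

Lemma normal_point_normal x : normal_points K x ->
  bnd K x /\ outer_unit_normals K x = [set outer_normal K x].
Proof.
move=> [bx [k [_ [u [A [xu _ _ _ _]]]]]]; split=> //.
by rewrite (outer_normalE xu).
Qed.

Lemma dot_outer_normal_gt0 x : normal_points K x -> 0 < dot x (outer_normal K x).
Proof.
move=> /normal_point_normal[_ xu]; apply: (dot_normal_gt0 K0).
by rewrite xu.
Qed.

Lemma gauss_curvature_ge x : normal_points K x ->
  r^-1 ^+ n.-1 <= gauss_curvature K x.
Proof.
move=> Dx; rewrite -[X in _ ^+ X]card_ord -prodr_const.
apply: ler_prod => i _; rewrite invr_ge0 (ltW r_gt0)/=.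
exact: (curvature_ge r_gt0 K_compact K_ball K0).
Qed.

(** Besides positivity, a bound uniform in [x] is wanted: it keeps the integral finite for
    [t > 1 / n] once it is finite at [1 / n], the exponent of the ratio being smaller there. *)
Lemma curvature_ratio_ge x : normal_points K x ->
  (r^-1 ^+ n.-1) `^ n.+1%:R^-1 / (r *+ 2) <= curvature_ratio x.
Proof.
move=> Dx; have [bx xu] := normal_point_normal Dx.
have ri : 0 <= r^-1 ^+ n.-1 by rewrite exprn_ge0// invr_ge0 ltW.
have k_ge := gauss_curvature_ge Dx.
apply: ler_pM; rewrite ?powR_ge0 ?invr_ge0 ?mulrn_wge0 ?(ltW r_gt0)//.
  by rewrite ge0_ler_powR ?nnegrE ?invr_ge0// (le_trans ri).
rewrite lef_pV2 ?posrE ?pmulrn_lgt0 ?dot_outer_normal_gt0//.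
exact: (dot_normal_le r_gt0 K_compact K_ball K0).
Qed.

Lemma curvature_ratio_gt0 x : normal_points K x -> 0 < curvature_ratio x.
Proof.
move=> Dx; apply: lt_le_trans (curvature_ratio_ge Dx).
by rewrite divr_gt0 ?powR_gt0 ?exprn_gt0 ?invr_gt0 ?pmulrn_lgt0.
Qed.

(** The shifted curvatures are nonnegative, so the power moves outside the product. What stands
    inside is then a determinant in the normal and the Hessian, which is measurable. *)
Lemma curvature_weightE x : normal_points K x ->
  curvature_weight x =
  (\prod_(i < n.-1) (curvature K x i - r^-1)) `^ n.+1%:R^-1.
Proof.
move=> Dx.
have [] // : 0 <= \prod_(i < n.-1) (curvature K x i - r^-1) /\ curvature_weight x =
  (\prod_(i < n.-1) (curvature K x i - r^-1)) `^ n.+1%:R^-1.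
rewrite /curvature_weight; elim/big_ind2 : _ => [|a b c d [b0 ->] [d0 ->]|i _].
- by rewrite powR1 ler01.
- by rewrite powRM// mulr_ge0.
- by rewrite subr_ge0 (curvature_ge r_gt0 K_compact K_ball K0).
Qed.

Lemma curvature_weight_ge0 x : 0 <= curvature_weight x.
Proof. by apply: prodr_ge0 => i _; exact: powR_ge0. Qed.

Lemma measurable_curvature_ratio :
  measurable_fun (normal_points K : set HT) (curvature_ratio : HT -> R).
Proof.
have mD := measurable_normal_points r_gt0 K_compact K_ball K0.
apply: (eq_measurable_fun (fun x : HT =>
  (\prod_(i < n.-1) (curvature K x i - 0)) `^ n.+1%:R^-1
   * dot x (outer_normal K x) `^ (-1))).
  move=> x /set_mem Dx; rewrite powR_inv1 ?ltW ?dot_outer_normal_gt0//.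
  by rewrite /curvature_ratio /gauss_curvature; under eq_bigr do rewrite subr0.
apply: measurable_funM.
  apply: (measurableT_comp (@measurable_powR R n.+1%:R^-1)).
  exact: (measurable_prod_curvature r_gt0 K_compact K_ball K0).
apply: (measurableT_comp (@measurable_powR R (-1))).
exact: (measurable_dot_normal r_gt0 K_compact K_ball K0).
Qed.

Lemma measurable_curvature_weight :
  measurable_fun (normal_points K : set HT) (curvature_weight : HT -> R).
Proof.
apply: (eq_measurable_fun (fun x : HT =>
  (\prod_(i < n.-1) (curvature K x i - r^-1)) `^ n.+1%:R^-1)).
  by move=> x /set_mem Dx; rewrite curvature_weightE.
apply: (measurableT_comp (@measurable_powR R n.+1%:R^-1)).
exact: (measurable_prod_curvature r_gt0 K_compact K_ball K0).
Qed.

Lemma Lp_relative_surface_areaE p : Lp_relative_surface_area r K p =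
  power_integral surface_measure (normal_points K)
    curvature_ratio curvature_weight (Lp_exponent (n := n) p).
Proof. by []. Qed.

End integrands.

Lemma Lp_exponentE (R : realType) (n : nat) (p : R) : - n%:R < p ->
  Lp_exponent (n := n) p%:E = n%:R - n%:R * (n%:R + 1) * (n%:R + p)^-1.
Proof.
by rewrite -subr_gt0 opprK addrC => np; rewrite /Lp_exponent; field; rewrite gt_eqF.
Qed.

Theorem proposition5 (R : realType) (n : nat) (r : R) (K : set 'rV[R]_n)
    (r_gt0 : 0 < r) (K_body : convex_body K) (K_ball : ball_convex r K)
    (K0 : interior K 0)
    (K_curv : (0 < hausdorff n.-1
      [set x | normal_points K x /\ forall i, (r^-1 < curvature K x i)%R])%E) :
  {in [pred p : R | - n%:R < p] &, forall p q, p <= q ->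
    ((Lp_relative_surface_area r K q%:E / Lp_relative_surface_area r K +oo)
       `^ (n%:R + q)
     <= (Lp_relative_surface_area r K p%:E / Lp_relative_surface_area r K +oo)
       `^ (n%:R + p))%E} /\
  {in [pred p : R | (- n%:R < p) && (p != 0)] &, forall p q, p <= q ->
    ((Lp_relative_surface_area r K p%:E / Lp_relative_surface_area r K 0)
       `^ ((n%:R + p) / p)
     <= (Lp_relative_surface_area r K q%:E / Lp_relative_surface_area r K 0)
       `^ ((n%:R + q) / q))%E}.
Proof.
have [K_compact _ _] := K_body.
(* A set of positive measure has a point, and a unit normal at that point forces positive dimension;
   [1 / n] can then serve as the parameter of [p = 0]. *)
have n_gt0 : (0 < n)%N.
  have [x [Dx _]] :
      [set x | normal_points K x /\ forall i, r^-1 < curvature K x i] !=set0.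
    by apply/set0P; apply: contraTneq K_curv => ->; rewrite hausdorff0 ltxx.
  have [_ xu] := normal_point_normal Dx.
  have [u1 _] : outer_unit_normals K x (outer_normal K x) by rewrite xu.
  exact: unit_vector_dim u1.
have n0 : 0 < n%:R :> R by rewrite ltr0n.
have mD := measurable_normal_points r_gt0 K_compact K_ball K0.
have mg := measurable_curvature_ratio r_gt0 K_compact K_ball K0.
have mh := measurable_curvature_weight r_gt0 K_compact K_ball K0.
have g_gt0 := curvature_ratio_gt0 r_gt0 K_compact K_ball K0.
have h_ge0 x (_ : normal_points K x) := curvature_weight_ge0 r K x.
pose I := power_integral (@surface_measure R n)
  (normal_points K) (curvature_ratio K) (curvature_weight r K).
pose J t := I (n%:R - n%:R * (n%:R + 1) * t).
have OmegaE (p : R) : - n%:R < p ->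
    Lp_relative_surface_area r K p%:E = J (n%:R + p)^-1.
  by move=> np; rewrite Lp_relative_surface_areaE Lp_exponentE.
have Omega_oo : Lp_relative_surface_area r K +oo%E = J 0.
  by rewrite Lp_relative_surface_areaE /J mulr0 subr0.
have J_ge0 t : (0 <= J t)%E by apply: power_integral_ge0.
have J_eq0 s t : J s = 0%E -> J t = 0%E.
  exact: (power_integral_eq0 mD mg mh g_gt0 h_ge0).
have J_convex s w l u v : 0 < l < 1 -> 0 < u -> 0 < v ->
    J s = u%:E -> J w = v%:E ->
    (J ((1 - l)%R * s + l * w)%R <= (u `^ (1 - l) * v `^ l)%:E)%E.
  move=> l01 u0 v0 Js Jw; rewrite /J.
  rewrite (_ : _ - _ = (1 - l) * (n%:R - n%:R * (n%:R + 1) * s) +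
    l * (n%:R - n%:R * (n%:R + 1) * w)); last by ring.
  exact: (power_integral_log_convex mD mg mh g_gt0 h_ge0).
have J_lty t : n%:R^-1 < t -> (J n%:R^-1%R < +oo -> J t < +oo)%E.
  move=> ct; apply: (power_integral_lty mD mg mh g_gt0 h_ge0).
    exists ((r^-1 ^+ n.-1) `^ n.+1%:R^-1 / (r *+ 2)).
      by rewrite divr_gt0 ?powR_gt0 ?exprn_gt0 ?invr_gt0 ?pmulrn_lgt0.
    exact: (curvature_ratio_ge r_gt0 K_compact K_ball K0).
  rewrite lerD2l lerN2; apply: ler_wpM2l (ltW ct).
  by rewrite natr1 -natrM ler0n.
have pos (p : R) : - n%:R < p -> 0 < n%:R + p by rewrite -subr_gt0 opprK addrC.
split=> p q; rewrite !inE.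
  move=> np nq pq; rewrite !OmegaE// Omega_oo.
  rewrite -[X in (_ `^ X <= _)%E]invrK -[X in (_ <= _ `^ X)%E]invrK.
  apply: (ratio_root_le J_ge0 J_eq0 J_convex); first by rewrite invr_gt0 pos.
  by rewrite lef_pV2 ?posrE ?pos// lerD2l.
move=> /andP[np p0] /andP[nq q0] pq.
rewrite !OmegaE ?oppr_lt0// addr0.
(* The exponent takes the form [k / (c - t)] with [c = k = 1 / n] and [t = 1 / (n + s)], so that
   slopes are taken from the base point [1 / n]. *)
have expE (s : R) : - n%:R < s -> s != 0 ->
    (n%:R + s) / s = n%:R^-1 / (n%:R^-1 - (n%:R + s)^-1).
  move=> ns s0; have ns0 := pos _ ns.
  have -> : n%:R^-1 - (n%:R + s)^-1 = s / (n%:R * (n%:R + s)).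
    by field; rewrite !lt0r_neq0.
  by field; rewrite s0 !lt0r_neq0.
rewrite !expE//.
have neq (s : R) : s != 0 -> (n%:R + s)^-1 != n%:R^-1.
  by move=> s0; rewrite (inj_eq invr_inj) -subr_eq0 addrAC subrr add0r.
apply: (ratio_root_ge J_ge0 J_eq0 J_convex); rewrite ?invr_gt0 ?neq//.
by rewrite lef_pV2 ?posrE ?pos// lerD2l.
Qed.
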